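(* Let $h>0$ and let $\lambda,\mu\in\mathbb{R}$ satisfy $\mu>0$, $\lambda+\mu>0$. The eigenvalues of the Dirichlet-free (DF) eigenvalue problem for the operator of linear elasticity on the flat two-dimensional cylinder $M=\mathbb{T}\times[0,h]$ are: (i) $\frac{k^2\pi^2}{h^2}(\lambda+2\mu)$, $k=1,2,\dots$, with multiplicity $1$; (ii) $\frac{k^2\pi^2}{h^2}\mu$, $k=1,2,\dots$, with multiplicity $1$; (iii) $n^2\mu$, $n=1,2,\dots$, with multiplicity $2$; (iv) $\left(n^2+\frac{k^2\pi^2}{h^2}\right)\mu$, $n,k=1,2,\dots$, with multiplicity $2$; (v) $\left(n^2+\frac{k^2\pi^2}{h^2}\right)(\lambda+2\mu)$, $n,k=1,2,\dots$, with multiplicity $2$.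
   Context: $\mathbb{T}=\mathbb{R}/2\pi\mathbb{Z}$ is the one-dimensional torus; $M$ has coordinates $(x^1,x^2)\in[0,2\pi)\times[0,h]$ and the flat metric, with boundary $\partial M=\{x^2=0\}\cup\{x^2=h\}$. The operator of linear elasticity acts on vector fields $\mathbf{u}=(u_1,u_2)$ by $\mathcal{L}\mathbf{u}=-\mu\Delta\mathbf{u}-(\lambda+\mu)\operatorname{grad}\operatorname{div}\mathbf{u}$ ($\Delta=\partial_1^2+\partial_2^2$ acting componentwise). With $\mathbf{n}$ the exterior unit normal to $\partial M$, the boundary traction operator is $(\mathcal{T}\mathbf{u})_\alpha=\lambda n_\alpha\partial_\beta u_\beta+\mu(n_\beta\partial_\beta u_\alpha+n_\beta\partial_\alpha u_\beta)$ (summation over $\beta$). The DF eigenvalue problem is: find $\mathbf{u}\in H^1(M)$, $\mathbf{u}\neq0$, and $\Lambda\in\mathbb{R}$ with $\mathcal{L}\mathbf{u}=\Lambda\mathbf{u}$ in $M$, subject to $\mathbf{u}-(\mathbf{n}\cdot\mathbf{u})\mathbf{n}=0$ and $\mathbf{n}\cdot\mathcal{T}\mathbf{u}=0$ on $\partial M$. Eigenvalues are enumerated with account of multiplicity; when values from the listed series coincide, their multiplicities add.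
   Formalization: The printed list omits the eigenvalue 0, which occurs for the constant field u=(0,1); the formal theorem asserts the list (i)–(v) with its multiplicities for all nonzero Λ and adds that 0 is an eigenvalue of multiplicity 1. *)

(* Defs.v *)
From HB Require Import structures.
From mathcomp Require Import all_boot all_order all_algebra finmap.
From mathcomp Require Import all_classical all_reals all_analysis.
Set Implicit Arguments.
Unset Strict Implicit.
Unset Printing Implicit Defensive.
Import Order.TTheory GRing.Theory Num.Theory numFieldNormedType.Exports.
Local Open Scope classical_set_scope.
Local Open Scope ring_scope.

(* The torus is R / 2 pi Z.  An integrable function on M = T x [0, h] is        *)
(* represented by a function on R * R of which only the values on the           *)
(* fundamental domain [0, 2 pi] x [0, h] matter, up to a null set.  A smooth    *)
(* function on M (up to the boundary) is represented by a smooth function on    *)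
(* R * R that is 2 pi-periodic in the first coordinate.  The coordinates        *)
(* (x^1, x^2) are (p.1, p.2), and the component indices 1, 2 are 0, 1 : 'I_2.   *)

Definition cylinder {R : realType} (h : R) : set (R * R) :=
  `[0, 2 * pi] `*` `[0, h].

Notation area R := (@lebesgue_measure R \x @lebesgue_measure R)%E.

Definition vfield (R : realType) := 'I_2 -> R * R -> R.

Section SmoothFields.
Context {R : realType}.
Implicit Types (f : R * R -> R) (v : vfield R) (i : 'I_2) (lambda mu h : R).

Definition coord_dir i : R * R := ((i == 0)%:R, (i == 1)%:R).

Definition partial i f : R * R -> R := fun p => 'D_(coord_dir i) f p.

Definition smooth f : Prop := forall s : seq 'I_2,
  let g := foldr partial f s in
  continuous g /\ forall i p, derivable g p (coord_dir i).

Definition smooth_on_cylinder f : Prop :=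
  smooth f /\ forall x y : R, f (x + 2 * pi, y) = f (x, y).

Definition compact_support_inside h f : Prop :=
  exists2 d : R, 0 < d & forall p, f p != 0 -> d <= p.2 <= h - d.

Definition div v : R * R -> R := fun p => \sum_(b < 2) partial b (v b) p.

Definition elasticity lambda mu v : vfield R := fun a p =>
  - mu * (\sum_(b < 2) partial b (partial b (v a)) p)
  - (lambda + mu) * partial a (div v) p.

End SmoothFields.

Section Boundary.
Context {R : realType}.
Implicit Types (h : R) (s : bool) (w : 'I_2 -> R) (a b : 'I_2).

(* s = false is the component x^2 = 0, s = true the component x^2 = h *)
Definition height h s : R := if s then h else 0.

Definition normal s b : R := if b == 0 then 0 else if s then 1 else -1.

Definition tangential s w a : R :=
  w a - (\sum_(b < 2) normal s b * w b) * normal s a.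

End Boundary.

Section Sobolev.
Context {R : realType}.
Implicit Types (h : R) (f g : R * R -> R) (u : vfield R).

Definition square_integrable h f : Prop :=
  measurable_fun (cylinder h) f /\
  (area R).-integrable (cylinder h) (fun p => (f p ^+ 2)%:E).

Definition weak_partial h (i : 'I_2) f g : Prop :=
  forall phi, smooth_on_cylinder phi -> compact_support_inside h phi ->
  \int[area R]_(p in cylinder h) (f p * partial i phi p) =
  - \int[area R]_(p in cylinder h) (g p * phi p).

(* u is in H^1(M), with weak first derivatives Du a b of u_a in direction b *)
Definition in_H1 h u (Du : 'I_2 -> vfield R) : Prop :=
  (forall a, square_integrable h (u a)) /\
  (forall a b, square_integrable h (Du a b) /\
               weak_partial h b (u a) (Du a b)).

(* u - (n . u) n = 0 on the boundary, in the sense of traces.  The trace is the *)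
(* continuous extension to H^1(M) of the restriction of smooth fields to the    *)
(* boundary: the phi m converge to u in H^1(M), hence their boundary values     *)
(* converge to the trace of u in L^2, and the limit of the tangential parts of  *)
(* these is the tangential part of the trace.                                   *)
Definition tangential_trace_zero h u (Du : 'I_2 -> vfield R) : Prop :=
  exists phi : nat -> vfield R,
  [/\ forall m a, smooth_on_cylinder (phi m a),
      forall a,
        \int[area R]_(p in cylinder h) ((phi m a p - u a p) ^+ 2)
          @[m --> \oo] --> (0 : R),
      forall a b,
        \int[area R]_(p in cylinder h) ((partial b (phi m a) p - Du a b p) ^+ 2)
          @[m --> \oo] --> (0 : R) &
      forall s a,
        \int[@lebesgue_measure R]_(x in `[0, 2 * pi])
          ((tangential s (fun b => phi m b (x, height h s)) a) ^+ 2)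
          @[m --> \oo] --> (0 : R)].

End Sobolev.

Section DirichletFree.
Context {R : realType}.
Implicit Types (lambda mu h Lam : R) (u v F : vfield R) (Du : 'I_2 -> vfield R).

(* L u = F in the sense of distributions; L is formally self-adjoint *)
Definition weak_elasticity lambda mu h u F : Prop :=
  forall v, (forall a, smooth_on_cylinder (v a)) ->
    (forall a, compact_support_inside h (v a)) ->
  \int[area R]_(p in cylinder h)
    (\sum_(a < 2) u a p * elasticity lambda mu v a p) =
  \int[area R]_(p in cylinder h) (\sum_(a < 2) F a p * v a p).

(* (T u)_a = \sum_b n_b * stress Du a b *)
Definition stress lambda mu Du (a b : 'I_2) : R * R -> R := fun p =>
  lambda * (a == b)%:R * (\sum_(c < 2) Du c c p) + mu * (Du a b p + Du b a p).

(* The traction of a field u in H^1(M) such that L u = F is square integrable   *)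
(* is the functional on boundary values given by Green's formula                *)
(*   \int_{dM} T u . v = \int_M stress(u) : grad v - \int_M L u . v.             *)
Definition traction_pairing lambda mu h Du F v : R :=
  \int[area R]_(p in cylinder h)
    (\sum_(a < 2) \sum_(b < 2) stress lambda mu Du a b p * partial b (v a) p)
  - \int[area R]_(p in cylinder h) (\sum_(a < 2) F a p * v a p).

(* n . T u = 0: the traction vanishes against all fields normal to the boundary *)
Definition normal_traction_zero lambda mu h Du F : Prop :=
  forall v, (forall a, smooth_on_cylinder (v a)) ->
    (forall s a x, tangential s (fun b => v b (x, height h s)) a = 0) ->
  traction_pairing lambda mu h Du F v = 0.

Definition DF_solution lambda mu h Lam u : Prop :=
  exists Du : 'I_2 -> vfield R,
  let F : vfield R := fun a p => Lam * u a p in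
  [/\ in_H1 h u Du,
      weak_elasticity lambda mu h u F,
      tangential_trace_zero h u Du &
      normal_traction_zero lambda mu h Du F].

Definition vanishes h u : Prop :=
  {ae area R, forall p, cylinder h p -> forall a, u a p = 0}.

Definition DF_eigenvalue lambda mu h Lam : Prop :=
  exists2 u, DF_solution lambda mu h Lam u & ~ vanishes h u.

(* the space of solutions, modulo equality almost everywhere, has dimension d *)
Definition DF_multiplicity lambda mu h Lam (d : nat) : Prop :=
  exists e : 'I_d -> vfield R,
  [/\ forall i, DF_solution lambda mu h Lam (e i),
      forall c : 'I_d -> R,
        vanishes h (fun a p => \sum_(i < d) c i * e i a p) ->
        forall i, c i = 0 &
      forall u, DF_solution lambda mu h Lam u ->
        exists c : 'I_d -> R,
          vanishes h (fun a p => u a p - \sum_(i < d) c i * e i a p)].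

(* The number of occurrences of Lam in the five series.  When h > 0, mu > 0 and *)
(* lambda + mu > 0 all these sets are finite, so that fset_set is faithful.     *)
Definition listed_multiplicity lambda mu h Lam : nat :=
  let series1 := [set k : nat | (0 < k)%N /\
    Lam = k%:R ^+ 2 * pi ^+ 2 / h ^+ 2 * (lambda + 2 * mu)] in
  let series2 := [set k : nat | (0 < k)%N /\
    Lam = k%:R ^+ 2 * pi ^+ 2 / h ^+ 2 * mu] in
  let series3 := [set n : nat | (0 < n)%N /\ Lam = n%:R ^+ 2 * mu] in
  let series4 := [set nk : nat * nat | [/\ (0 < nk.1)%N, (0 < nk.2)%N &
    Lam = (nk.1%:R ^+ 2 + nk.2%:R ^+ 2 * pi ^+ 2 / h ^+ 2) * mu]] in
  let series5 := [set nk : nat * nat | [/\ (0 < nk.1)%N, (0 < nk.2)%N &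
    Lam = (nk.1%:R ^+ 2 + nk.2%:R ^+ 2 * pi ^+ 2 / h ^+ 2)
          * (lambda + 2 * mu)]] in
  (#|` fset_set series1| + #|` fset_set series2| + 2 * #|` fset_set series3|
   + 2 * #|` fset_set series4| + 2 * #|` fset_set series5|)%N.

End DirichletFree.

(* Main.v *)
Require Import Defs.
From mathcomp Require Import all_boot all_order all_algebra finmap.
From mathcomp Require Import all_classical all_reals all_analysis.
From mathcomp Require Import measurable_realfun ring lra.
Set Implicit Arguments.
Unset Strict Implicit.
Unset Printing Implicit Defensive.
Import Order.TTheory GRing.Theory Num.Theory numFieldNormedType.Exports.
Local Open Scope classical_set_scope.
Local Open Scope ring_scope.

(** Both boundary conditions are respected by separation of variables.  For
    wave numbers n and kappa = k pi / h and a phase phi, put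
      u_1 = A sin (n x + phi) sin (kappa y),
      u_2 = B cos (n x + phi) cos (kappa y).
    At y = 0 and y = h the tangential component u_1 vanishes because
    sin (kappa y) does, and so does the normal stress, in which only
    sin (kappa y) occurs.  The elasticity operator acts on such a mode through
    a symmetric 2 x 2 matrix acting on (A, B), with eigenvectors (n, - kappa)
    (compression, eigenvalue (lambda + 2 mu) (n^2 + kappa^2)) and (kappa, n)
    (shear, eigenvalue mu (n^2 + kappa^2)).  Hence these eigenmodes solve the
    problem (mode_DF_solution).  The phases 0 and pi / 2 give two of them for
    n > 0; for n = 0 or k = 0 some vanish identically, which leaves the
    multiplicities of the five series.  The pair n = k = 0 contributes the
    constant field (0, 1), with eigenvalue 0.

    Conversely, let u be a solution for Lam' and e an eigenmode for Lam.  The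
    traction condition tested with e expresses the elastic energy of (u, e) as
    Lam' times their scalar product.  Green's formula for the smooth fields
    that approximate u expresses it as Lam times the scalar product: the only
    boundary term is the shear stress of e times u_1, which tends to 0 by the
    trace condition.  Hence (Lam' - Lam) <u, e> = 0
    (solution_mode_orthogonal).  The eigenmodes are pairwise orthogonal, and a square-integrable
    field orthogonal to all of them vanishes, since for (n, k) <> (0, 0) the
    two eigenvectors span the plane of amplitudes and the underlying Fourier
    systems are complete (eigenfields_complete).  So the solutions for Lam are
    exactly the span of the eigenmodes with that eigenvalue
    (multiplicity_enum), which leaves counting indices (listed_enumeration).

    Completeness is a problem of moments.  If f is orthogonal to the Fourier
    system, then it is orthogonal to all products of powers of cos (x - x0) and
    cos (pi y / h).  A sequence of polynomials that converges boundedly to a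
    step function turns this, by dominated convergence, into the vanishing of
    the integral of f over the sets where the two cosines lie below given
    thresholds.  These sets are the rectangles of a generating family, and
    Dynkin's lemma gives the integral over every measurable set, so that f = 0
    almost everywhere (vanishing_moments_ae0). *)

(** * Measurability in the plane *)

Section Plane.
Context {R : realType}.
Implicit Types (f g : R * R -> R) (h x y : R) (i : 'I_2).

(** The product sigma-algebra of the two Borel lines contains the open sets,
    because an open set is the union of the countably many boxes with rational
    centre and radius that it contains. *)
Lemma open_measurable_plane (U : set (R * R)) : open U -> measurable U.
Proof.
move=> oU.
pose B (q : rat * rat * rat) : set (R * R) :=
  ball (ratr q.1.1 : R) (ratr q.2) `*` ball (ratr q.1.2 : R) (ratr q.2).
suff -> : U = \bigcup_q (if `[< B q `<=` U >] then B q else set0).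
  apply: countable_bigcupT_measurable => [|q]; first exact: countableP.
  case: ifPn => // _; by apply: measurableX; exact: measurable_ball.
apply/seteqP; split => [[x y] Uxy|p [q _]]; last first.
  by case: asboolP => [BU|//] Bp; exact: BU.
have /nbhs_ballP[e /= e0 eU] : nbhs (x, y) U by exact: open_nbhs_nbhs.
have e4 : 0 < e / 4 by rewrite divr_gt0.
have e42 : e / 4 < e / 2 by rewrite ltr_pM2l// ltf_pV2 ?posrE// ltr_nat.
have [r] := rat_in_itvoo e42; rewrite in_itv/= => /andP[r1 r2].
have near z : exists q : rat, `|ratr q - z| < e / 4.
  have /rat_in_itvoo[q] : z - e / 4 < z + e / 4 by lra.
  rewrite in_itv/= => /andP[q1 q2]; exists q.
  by rewrite ltr_distl q1 q2.
(* radius r > e / 4 so that the box reaches (x, y), and r < e / 2 so that it stays in the ball *)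
have [a ax] := near x; have [b yb] := near y.
exists (a, b, r) => //.
rewrite asboolT.
  by split; rewrite /ball/= ; [exact: lt_trans ax _|exact: lt_trans yb _].
move=> [u v] [/=]; rewrite /ball/= => ua vb; apply: eU; split => /=.
  rewrite /ball/= (le_lt_trans (ler_distD (ratr a) _ _))// distrC.
  by have := ltrD ax ua; lra.
rewrite /ball/= (le_lt_trans (ler_distD (ratr b) _ _))// distrC.
by have := ltrD yb vb; lra.
Qed.

Lemma continuous_measurable_plane f : continuous f -> measurable_fun setT f.
Proof.
move=> cf; apply: (measurability _ (RGenOpens.measurableE R)).
move=> _ [_ [a [b ->] <-]]; rewrite setTI.
apply: open_measurable_plane; move/continuousP: cf; apply.
exact: interval_open.
Qed.

End Plane.

(** * Integrals over the cylinder *)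

Section CylinderIntegral.
Context {R : realType}.
Implicit Types (f g : R * R -> R) (h x y : R).
Notation leb := (@lebesgue_measure R).

Lemma cylinder_measurable h :
  measurable (cylinder h : set (measurableTypeR R * measurableTypeR R)).
Proof. by apply: measurableX; exact: measurable_itv. Qed.
Hint Resolve cylinder_measurable : core.

Lemma cylinder_area h : 0 < h -> area R (cylinder h) = (2 * pi * h)%:E.
Proof.
move=> h0; rewrite product_measure1E//; [|exact: measurable_itv..].
have pi2 : 0 < 2 * pi :> R by rewrite mulr_gt0// pi_gt0.
have lI (r : R) : 0 < r -> leb `[0, r]%classic = r%:E.
  by move=> r0; rewrite lebesgue_measure_itv/= lte_fin r0 -EFinB subr0.
by apply: (etrans (congr2 mule (lI _ pi2) (lI _ h0))).
Qed.

Lemma continuous_bounded_cylinder h f : continuous f ->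
  exists M, forall p, cylinder h p -> `|f p| <= M.
Proof.
move=> cf; have cD : compact (cylinder h).
  by apply: compact_setX; exact: segment_compact.
have /compact_bounded[M [_ Mf]] : compact (f @` cylinder h).
  by apply: continuous_compact => //; exact: continuous_subspaceT.
by exists (M + 1) => p Dp; apply: Mf; [rewrite ltrDl|exists p].
Qed.

(** The cylinder has finite area, and a continuous function is bounded on it by
    compactness. *)
Lemma continuous_integrable_cylinder h f : 0 < h -> continuous f ->
  (area R).-integrable (cylinder h) (EFin \o f).
Proof.
move=> h0 cf; apply: measurable_bounded_integrable => //.
- by have := ltry (2 * pi * h); rewrite -(cylinder_area h0).
- by apply: measurable_funTS; exact: continuous_measurable_plane.
- have [M Mf] := continuous_bounded_cylinder h cf.
  by exists M; split; [exact: num_real|] => N MN p Dp; apply: le_trans (Mf p Dp) _; exact: ltW.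
Qed.

(** Fubini's theorem, with the indicator function of the cylinder split into the
    two indicator functions of intervals. *)
Lemma integral_cylinder12 h f : 0 < h -> continuous f ->
  \int[area R]_(p in cylinder h) f p =
  \int[leb]_(x in `[0, 2 * pi]) \int[leb]_(y in `[0, h]) f (x, y).
Proof.
move=> h0 cf; rewrite /Rintegral integral_mkcond.
rewrite -integral12_prod_meas1; last first.
  apply: (iffLR (integrable_mkcond (mu := area R) (EFin \o f)
    (cylinder_measurable h))).
  exact: continuous_integrable_cylinder.
congr fine; rewrite [RHS]integral_mkcond; apply: eq_integral => x _.
rewrite /fubini_F [RHS]/patch; case: ifPn => xI; last first.
  rewrite integral0_eq// => y _; rewrite /patch ifF//; apply/negbTE.
  by apply: contraNN xI; rewrite !inE => -[].
rewrite fineK; last first.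
  apply: integrable_fin_num => //; apply: continuous_compact_integrable.
    exact: segment_compact.
  apply: continuous_subspaceT => y; apply: continuous_comp; last exact: cf.
  exact: cvg_pair (cvg_cst _) cvg_id.
rewrite [RHS]integral_mkcond; apply: eq_integral => y _; rewrite /patch.
suff -> : ((x, y) \in cylinder h) = (y \in `[0, h]%classic) by [].
apply/idP/idP; rewrite !inE /cylinder/=; [by case|].
by split=> //=; rewrite inE in xI.
Qed.

Lemma integral_cylinder21 h f : 0 < h -> continuous f ->
  \int[area R]_(p in cylinder h) f p =
  \int[leb]_(y in `[0, h]) \int[leb]_(x in `[0, 2 * pi]) f (x, y).
Proof.
move=> h0 cf; rewrite /Rintegral integral_mkcond.
rewrite -integral21_prod_meas1; last first.
  apply: (iffLR (integrable_mkcond (mu := area R) (EFin \o f)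
    (cylinder_measurable h))).
  exact: continuous_integrable_cylinder.
congr fine; rewrite [RHS]integral_mkcond; apply: eq_integral => y _.
rewrite /fubini_G [RHS]/patch; case: ifPn => yI; last first.
  rewrite integral0_eq// => x _; rewrite /patch ifF//; apply/negbTE.
  by apply: contraNN yI; rewrite !inE => -[].
rewrite fineK; last first.
  apply: integrable_fin_num => //; apply: continuous_compact_integrable.
    exact: segment_compact.
  apply: continuous_subspaceT => x; apply: continuous_comp; last exact: cf.
  exact: cvg_pair cvg_id (cvg_cst _).
rewrite [RHS]integral_mkcond; apply: eq_integral => x _; rewrite /patch.
suff -> : ((x, y) \in cylinder h) = (x \in `[0, 2 * pi]%classic) by [].
apply/idP/idP; rewrite !inE /cylinder/=; [by case|].
by split=> //=; rewrite inE in yI.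
Qed.

Definition cint h f : R := \int[area R]_(p in cylinder h) f p.

Definition cintegrable h f := (area R).-integrable (cylinder h) (EFin \o f).

Lemma eq_cint h f g : (forall p, cylinder h p -> f p = g p) -> cint h f = cint h g.
Proof. by move=> fg; apply: eq_Rintegral => p /[!inE]; exact: fg. Qed.

Lemma cintD h f g : cintegrable h f -> cintegrable h g ->
  cint h (fun p => f p + g p) = cint h f + cint h g.
Proof. by move=> fi gi; apply: RintegralD => //; exact: cylinder_measurable. Qed.

Lemma cintB h f g : cintegrable h f -> cintegrable h g ->
  cint h (fun p => f p - g p) = cint h f - cint h g.
Proof. by move=> fi gi; apply: RintegralB => //; exact: cylinder_measurable. Qed.

Lemma cintZ h c f : cintegrable h f -> cint h (fun p => c * f p) = c * cint h f.
Proof. by move=> fi; apply: RintegralZl => //; exact: cylinder_measurable. Qed.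

Lemma cint0 h : cint h (fun=> 0) = 0.
Proof. by rewrite /cint Rintegral_cst ?mul0r//; exact: cylinder_measurable. Qed.

Lemma cintegrableD h f g : cintegrable h f -> cintegrable h g ->
  cintegrable h (fun p => f p + g p).
Proof. move=> fi gi; exact: (integrableD (cylinder_measurable h) fi gi). Qed.

Lemma cintegrableZ h c f : cintegrable h f -> cintegrable h (fun p => c * f p).
Proof. move=> fi; exact: (integrableZl (cylinder_measurable h) c fi). Qed.

Lemma cintegrable0 h : cintegrable h (fun=> 0).
Proof. by apply: integrable0; exact: cylinder_measurable. Qed.

Lemma cint_ge0 h f : (forall p, 0 <= f p) -> 0 <= cint h f.
Proof. by move=> f0; apply: Rintegral_ge0. Qed.

Lemma cintegrable_sum h n (F : 'I_n -> R * R -> R) :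
  (forall i, cintegrable h (F i)) -> cintegrable h (fun p => \sum_(i < n) F i p).
Proof.
elim: n F => [|n IH] F Fi.
  suff -> : (fun p => \sum_(i < 0) F i p) = (fun=> 0) by exact: cintegrable0.
  by apply/funext => p; rewrite big_ord0.
suff -> : (fun p => \sum_(i < n.+1) F i p) =
    (fun p => F ord0 p + \sum_(i < n) F (lift ord0 i) p).
  exact: cintegrableD (Fi ord0) (IH _ (fun i => Fi (lift ord0 i))).
by apply/funext => p; rewrite big_ord_recl.
Qed.

Lemma cint_sum h n (F : 'I_n -> R * R -> R) : (forall i, cintegrable h (F i)) ->
  cint h (fun p => \sum_(i < n) F i p) = \sum_(i < n) cint h (F i).
Proof.
elim: n F => [|n IH] F Fi.
  by rewrite big_ord0; apply: etrans _ (cint0 h); apply: eq_cint => p _; rewrite big_ord0.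
rewrite big_ord_recl -IH// -cintD//; last first.
  exact: cintegrable_sum.
by apply: eq_cint => p _; rewrite big_ord_recl.
Qed.

Lemma cint_sum2 h n m (F : 'I_n -> 'I_m -> R * R -> R) :
  (forall i j, cintegrable h (F i j)) ->
  cint h (fun p => \sum_(i < n) \sum_(j < m) F i j p) =
  \sum_(i < n) \sum_(j < m) cint h (F i j).
Proof.
move=> Fi; rewrite (cint_sum (F := fun i p => \sum_(j < m) F i j p)).
  by apply: eq_bigr => i _; exact: cint_sum.
by move=> i; exact: cintegrable_sum.
Qed.

End CylinderIntegral.

(** * Partial derivatives and integration by parts *)

Section Calculus.
Context {R : realType}.
Implicit Types (f g : R * R -> R) (h x y a b : R) (i : 'I_2).
Notation leb := (@lebesgue_measure R).

(** Along a coordinate direction, the difference quotient of f is that of a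
    function of one variable; this reduces partial derivatives to ordinary
    ones. *)
Lemma quotient_slice1 f x y :
  (fun r : R => r^-1 *: ((f \o shift (x, y)) (r *: coord_dir 0) - f (x, y))) =
  (fun r => r^-1 *: (((fun t => f (t, y)) \o shift x) (r *: 1) - f (x, y))).
Proof.
apply/funext => r /=; congr (_ *: (f _ - _)).
rewrite [LHS]surjective_pairing; congr pair; rewrite /= ?[_ *: 0]scaler0 ?add0r//.
Qed.

Lemma derivable_slice1 f x y :
  derivable f (x, y) (coord_dir 0) = derivable (fun t => f (t, y)) x 1.
Proof. by rewrite /derivable quotient_slice1. Qed.

Lemma partial_slice1 f x y : partial 0 f (x, y) = 'D_1 (fun t => f (t, y)) x.
Proof. by rewrite /partial /derive quotient_slice1. Qed.

Lemma is_derive_slice1 f x y : derivable f (x, y) (coord_dir 0) ->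
  is_derive x 1 (fun t => f (t, y)) (partial 0 f (x, y)).
Proof.
by rewrite derivable_slice1 partial_slice1 => df; exact: DeriveDef.
Qed.

Lemma quotient_slice2 f x y :
  (fun r : R => r^-1 *: ((f \o shift (x, y)) (r *: coord_dir 1) - f (x, y))) =
  (fun r => r^-1 *: (((fun t => f (x, t)) \o shift y) (r *: 1) - f (x, y))).
Proof.
apply/funext => r /=; congr (_ *: (f _ - _)).
rewrite [LHS]surjective_pairing; congr pair; rewrite /= ?[_ *: 0]scaler0 ?add0r//.
Qed.

Lemma derivable_slice2 f x y :
  derivable f (x, y) (coord_dir 1) = derivable (fun t => f (x, t)) y 1.
Proof. by rewrite /derivable quotient_slice2. Qed.

Lemma partial_slice2 f x y : partial 1 f (x, y) = 'D_1 (fun t => f (x, t)) y.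
Proof. by rewrite /partial /derive quotient_slice2. Qed.

Lemma is_derive_slice2 f x y : derivable f (x, y) (coord_dir 1) ->
  is_derive y 1 (fun t => f (x, t)) (partial 1 f (x, y)).
Proof.
by rewrite derivable_slice2 partial_slice2 => df; exact: DeriveDef.
Qed.

Lemma FTC_continuous (F F' : R -> R) a b : a < b ->
  (forall x, is_derive x 1 F (F' x)) -> continuous F' ->
  \int[leb]_(x in `[a, b]) F' x = F b - F a.
Proof.
move=> ab dF cF'.
have cF : continuous F.
  by move=> x; apply/differentiable_continuous/derivable1_diffP; apply: ex_derive.
rewrite /Rintegral (@continuous_FTC2 _ F' F)//.
- exact: continuous_subspaceT.
- split=> [x _||]; first exact: ex_derive.
  + by apply: cvg_at_right_filter; exact: cF.
  + by apply: cvg_at_left_filter; exact: cF.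
- by move=> x _; rewrite derive1E; exact: derive_val.
Qed.

(** The regularity needed to integrate by parts once; unlike smoothness, it is
    easily seen to be stable under products. *)
Definition C1 f := [/\ continuous f, forall i p, derivable f p (coord_dir i)
  & forall i, continuous (partial i f)].

Lemma continuous_slice1 f y : continuous f -> continuous (fun t => f (t, y)).
Proof.
move=> cf x; apply: continuous_comp; last exact: cf.
exact: cvg_pair cvg_id (cvg_cst _).
Qed.

Lemma continuous_slice2 f x : continuous f -> continuous (fun t => f (x, t)).
Proof.
move=> cf y; apply: continuous_comp; last exact: cf.
exact: cvg_pair (cvg_cst _) cvg_id.
Qed.

(** By Fubini's theorem and the fundamental theorem of calculus on vertical
    segments. *)
Lemma cint_partial2 h f : 0 < h -> C1 f ->
  cint h (partial 1 f) = \int[leb]_(x in `[0, 2 * pi]) (f (x, h) - f (x, 0)).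
Proof.
move=> h0 [cf df cdf]; rewrite /cint integral_cylinder12//.
apply: eq_Rintegral => x _.
exact: (FTC_continuous h0 (fun y => is_derive_slice2 (df 1 (x, y)))
  (@continuous_slice2 _ x (cdf 1))).
Qed.

(** As for the other coordinate, but periodicity cancels the boundary terms. *)
Lemma cint_partial1 h f : 0 < h -> C1 f -> (forall y, f (2 * pi, y) = f (0, y)) ->
  cint h (partial 0 f) = 0.
Proof.
move=> h0 [cf df cdf] pf; rewrite /cint integral_cylinder21//.
rewrite (eq_Rintegral _ (g := fun=> 0)) ?Rintegral_cst ?mul0r// => y _.
have pi2 : 0 < 2 * pi :> R by rewrite mulr_gt0// pi_gt0.
apply: etrans (FTC_continuous pi2 (fun x => is_derive_slice1 (df 0 (x, y)))
  (@continuous_slice1 _ y (cdf 0))) _.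
by rewrite pf subrr.
Qed.

Lemma partialM i f g p : C1 f -> C1 g ->
  partial i (fun p => f p * g p) p = f p * partial i g p + g p * partial i f p.
Proof. by move=> [_ df _] [_ dg _]; rewrite /partial; exact: deriveM. Qed.

Lemma partialD i f g p : C1 f -> C1 g ->
  partial i (fun p => f p + g p) p = partial i f p + partial i g p.
Proof. by move=> [_ df _] [_ dg _]; rewrite /partial; exact: deriveD. Qed.

Lemma C1M f g : C1 f -> C1 g -> C1 (fun p => f p * g p).
Proof.
move=> Cf Cg; have [cf df cdf] := Cf; have [cg dg cdg] := Cg; split.
- by move=> p; exact: continuousM (cf p) (cg p).
- by move=> i p; exact: derivableM.
- move=> i; rewrite (_ : partial i _ = (fun p => f p * partial i g p + g p * partial i f p)).
    move=> p; exact: continuousD (continuousM (cf p) (cdg i p))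
      (continuousM (cg p) (cdf i p)).
  by apply/funext => p; exact: partialM.
Qed.

Lemma C1_integrable_partialM h f g i : 0 < h -> C1 f -> C1 g ->
  cintegrable h (fun p => f p * partial i g p).
Proof.
move=> h0 [cf _ _] [_ _ cdg]; apply: continuous_integrable_cylinder => // p.
exact: continuousM (cf p) (cdg i p).
Qed.

Lemma cint_partialM h f g i : 0 < h -> C1 f -> C1 g ->
  cint h (partial i (fun p => f p * g p)) =
  cint h (fun p => f p * partial i g p) + cint h (fun p => g p * partial i f p).
Proof.
move=> h0 Cf Cg; rewrite -cintD; [|exact: C1_integrable_partialM..].
by apply: eq_cint => p _; rewrite partialM.
Qed.

Lemma cint_parts1 h f g : 0 < h -> C1 f -> C1 g ->
  (forall y, f (2 * pi, y) = f (0, y)) -> (forall y, g (2 * pi, y) = g (0, y)) ->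
  cint h (fun p => g p * partial 0 f p) = - cint h (fun p => f p * partial 0 g p).
Proof.
move=> h0 Cf Cg pf pg; apply/eqP; rewrite -addr_eq0 addrC -cint_partialM//.
apply/eqP; apply: cint_partial1 => //; first exact: C1M.
by move=> y; rewrite pf pg.
Qed.

Lemma cint_parts2 h f g : 0 < h -> C1 f -> C1 g ->
  (forall x, f (x, h) * g (x, h) = f (x, 0) * g (x, 0)) ->
  cint h (fun p => g p * partial 1 f p) = - cint h (fun p => f p * partial 1 g p).
Proof.
move=> h0 Cf Cg bfg; apply/eqP; rewrite -addr_eq0 addrC -cint_partialM//.
apply/eqP; rewrite cint_partial2//; last exact: C1M.
rewrite (eq_Rintegral _ (g := fun=> 0)) ?Rintegral_cst ?mul0r// => x _.
by rewrite bfg subrr.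
Qed.

End Calculus.

(** * Square-integrable functions *)

Section SquareIntegrable.
Context d (T : measurableType d) (R : realType) (mu : {measure set T -> \bar R}).
Variables (D : set T) (mD : measurable D).
Implicit Types f g : T -> R.

Definition L2 f := measurable_fun D f /\ mu.-integrable D (fun x => (f x ^+ 2)%:E).

Lemma L2M f g : L2 f -> L2 g -> mu.-integrable D (fun x => (f x * g x)%:E).
Proof.
move=> [mf if2] [mg ig2]; have ifg := integrableD mD if2 ig2.
apply: le_integrable ifg => //.
  by apply/measurable_EFinP; exact: measurable_funM.
move=> x _; rewrite /= lee_fin [leRHS]ger0_norm ?addr_ge0 ?sqr_ge0// ler_norml.
have := sqr_ge0 (f x + g x); have := sqr_ge0 (f x - g x).
have := sqr_ge0 (f x); have := sqr_ge0 (g x).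
by move=> g2 f2 fBg fDg; apply/andP; split; nra.
Qed.

Lemma L2D f g : L2 f -> L2 g -> L2 (fun x => f x + g x).
Proof.
move=> Lf Lg; have ifg := L2M Lf Lg; move: Lf Lg => [mf if2] [mg ig2].
split; first exact: measurable_funD.
have := integrableD mD (integrableD mD if2 ig2) (integrableZl mD 2 ifg).
by apply: eq_integrable => // x _ /=; congr EFin; ring.
Qed.

Lemma L2Z c f : L2 f -> L2 (fun x => c * f x).
Proof.
move=> [mf if2]; split; first exact: measurable_funM.
have := integrableZl mD (c ^+ 2) if2.
by apply: eq_integrable => // x _ /=; congr EFin; ring.
Qed.

Lemma L2B f g : L2 f -> L2 g -> L2 (fun x => f x - g x).
Proof.
move=> Lf Lg; have := L2D Lf (L2Z (-1) Lg).
rewrite (_ : (fun x => f x + -1 * g x) = (fun x => f x - g x))//.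
by apply/funext => x; rewrite mulN1r.
Qed.

(** The quadratic polynomial s |-> int (f + s g)^2 is nonnegative; it is enough
    to evaluate it at its minimum, or at one well-chosen s when int g^2 = 0. *)
Lemma cauchy_schwarz f g : L2 f -> L2 g ->
  (\int[mu]_(x in D) (f x * g x)) ^+ 2 <=
  \int[mu]_(x in D) (f x ^+ 2) * \int[mu]_(x in D) (g x ^+ 2).
Proof.
move=> Lf Lg; have ifg := L2M Lf Lg; have [_ if2] := Lf; have [_ ig2] := Lg.
set A := \int[mu]_(x in D) (f x ^+ 2); set B := \int[mu]_(x in D) (g x ^+ 2).
set C := \int[mu]_(x in D) _.
have quad (s : R) : 0 <= A + (2 * s * C + s ^+ 2 * B).
  have -> : A + (2 * s * C + s ^+ 2 * B) = \int[mu]_(x in D) ((f x + s * g x) ^+ 2).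
    have i1 : mu.-integrable D (EFin \o (fun x => 2 * s * (f x * g x))).
      exact: (integrableZl mD (2 * s) ifg).
    have i2 : mu.-integrable D (EFin \o (fun x => s ^+ 2 * (g x ^+ 2))).
      exact: (integrableZl mD (s ^+ 2) ig2).
    rewrite -RintegralZl// -RintegralZl// -RintegralD// -RintegralD//; last first.
      exact: (integrableD mD i1 i2).
    by apply: eq_Rintegral => x _; ring.
  by apply: Rintegral_ge0 => x _; exact: sqr_ge0.
have A0 : 0 <= A by apply: Rintegral_ge0 => x _; exact: sqr_ge0.
have B0 : 0 <= B by apply: Rintegral_ge0 => x _; exact: sqr_ge0.
(* if B = 0 the polynomial is affine, and s below would make it equal to -1 *)
have [BE|Bneq0] := eqVneq B 0.
  rewrite BE mulr0; have [->|Cneq0] := eqVneq C 0; first by rewrite expr0n.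
  have := quad (- (A + 1) / (2 * C)); rewrite BE mulr0 addr0.
  have -> : 2 * (- (A + 1) / (2 * C)) * C = - (A + 1) by field.
  lra.
have Bgt0 : 0 < B by rewrite lt_neqAle eq_sym Bneq0.
have := quad (- C / B).
have -> : A + (2 * (- C / B) * C + (- C / B) ^+ 2 * B) = (A * B - C ^+ 2) / B by field.
by rewrite pmulr_lge0 ?invr_gt0// subr_ge0.
Qed.

(** Convergence in mean square implies weak convergence.  The hypothesis is
    stated through real-valued integrals of squares, the form in which the
    approximation of Sobolev functions is given. *)
Lemma cvg_int_mul (phi : nat -> T -> R) f g :
  (forall m, L2 (phi m)) -> L2 f -> L2 g ->
  \int[mu]_(x in D) ((phi m x - f x) ^+ 2) @[m --> \oo] --> (0 : R) ->
  \int[mu]_(x in D) (phi m x * g x) @[m --> \oo] --> \int[mu]_(x in D) (f x * g x).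
Proof.
move=> Lphi Lf Lg phif; set B := \int[mu]_(x in D) (g x ^+ 2).
have B0 : 0 <= B by apply: Rintegral_ge0 => x _; exact: sqr_ge0.
have B1 : 0 < B + 1 by lra.
apply/cvgrPdist_lt => e e0.
have e2 : 0 < e ^+ 2 / (B + 1) by rewrite divr_gt0// exprn_gt0.
move/cvgrPdist_lt : phif => /(_ _ e2); apply: filterS => m.
rewrite sub0r normrN => small.
rewrite -RintegralB//; [|exact: L2M..].
rewrite (eq_Rintegral _ (g := fun x => (f x - phi m x) * g x)); last first.
  by move=> x _; rewrite mulrBl.
set I := \int[mu]_(x in D) _ in small.
have CS := cauchy_schwarz (L2B Lf (Lphi m)) Lg.
rewrite -/B in CS; set J := \int[mu]_(x in D) _ in CS *.
have IE : \int[mu]_(x in D) (f x - phi m x) ^+ 2 = I.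
  by apply: eq_Rintegral => x _; ring.
rewrite IE in CS; have I0 : 0 <= I by apply: Rintegral_ge0 => x _; exact: sqr_ge0.
rewrite ger0_norm// in small.
rewrite -ltr_sqr ?nnegrE ?normr_ge0 ?(ltW e0)// -normrX ger0_norm ?sqr_ge0//.
apply: le_lt_trans CS _; rewrite ltr_pdivlMr// in small.
apply: le_lt_trans small; nra.
Qed.

End SquareIntegrable.

(** * Trigonometric waves *)

Section Waves.
Context {R : realType}.
Implicit Types (f g : R * R -> R) (h x y a b c : R) (i : 'I_2).

Lemma ord2P i : i = 0 \/ i = 1.
Proof. by case: i => [[|[|//]]] ilt; [left|right]; exact: val_inj. Qed.

Lemma sum2E (V : nmodType) (F : 'I_2 -> V) : \sum_(i < 2) F i = F 0 + F 1.
Proof.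
by rewrite !big_ord_recl big_ord0 addr0; congr (F _ + F _); exact: val_inj.
Qed.

Lemma sum22E (V : nmodType) (F : 'I_2 -> 'I_2 -> V) :
  \sum_(i < 2) \sum_(j < 2) F i j = F 0 0 + F 0 1 + (F 1 0 + F 1 1).
Proof. by rewrite sum2E (sum2E (F 0)) (sum2E (F 1)). Qed.

(** Derivatives only multiply the amplitude and shift a phase by pi / 2, so
    that waves are closed under differentiation; sines are cosines with the
    phase - pi / 2. *)
Definition wave c a al b be : R * R -> R :=
  fun p => c * (cos (a * p.1 + al) * cos (b * p.2 + be)).

Lemma is_derive_cos_affine a al x :
  is_derive x 1 (fun t => cos (a * t + al)) (a * cos (a * x + al + pi / 2)).
Proof.
have d1 : is_derive x (1 : R) (fun t => a * t + al) a.
  have := is_deriveD (is_deriveZ a (is_derive_id x (1 : R))) (is_derive_cst al x (1 : R)).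
  by rewrite addr0 [a *: 1]mulr1.
have := @is_derive1_comp _ _ (fun t => a * t + al) x _ _
  (is_derive_cos (a * x + al)) d1.
by rewrite cosDpihalf mulrC.
Qed.

Lemma is_derive_wave1 c a al b be x y :
  is_derive x 1 (fun t => wave c a al b be (t, y))
    (wave (c * a) a (al + pi / 2) b be (x, y)).
Proof.
have := is_deriveZ (c * cos (b * y + be)) (is_derive_cos_affine a al x).
congr is_derive; first by apply/funext => t; rewrite /wave/= [LHS]mulrAC -mulrA.
transitivity (c * cos (b * y + be) * (a * cos (a * x + al + pi / 2))); first by [].
by rewrite /wave/= addrA; ring.
Qed.

Lemma is_derive_wave2 c a al b be x y :
  is_derive y 1 (fun t => wave c a al b be (x, t))
    (wave (c * b) a al b (be + pi / 2) (x, y)).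
Proof.
have := is_deriveZ (c * cos (a * x + al)) (is_derive_cos_affine b be y).
congr is_derive; first by apply/funext => t; rewrite /wave/= -[LHS]mulrA.
transitivity (c * cos (a * x + al) * (b * cos (b * y + be + pi / 2))); first by [].
by rewrite /wave/= addrA; ring.
Qed.

Lemma continuous_wave c a al b be : continuous (wave c a al b be).
Proof.
have cc (k l : R) (f : R * R -> R) : continuous f -> continuous (fun p => cos (k * f p + l)).
  move=> cf p; apply: continuous_comp; last exact: continuous_cos.
  exact: continuousD (continuousM (cvg_cst k) (cf p)) (cvg_cst l).
move=> p; apply: continuousM (cvg_cst c) (continuousM _ _).
  by apply: cc => q; exact: cvg_fst.
by apply: cc => q; exact: cvg_snd.
Qed.

Lemma derivable_wave c a al b be i p : derivable (wave c a al b be) p (coord_dir i).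
Proof.
case: p => x y; case: (ord2P i) => ->.
  by rewrite derivable_slice1; apply: ex_derive; exact: is_derive_wave1.
by rewrite derivable_slice2; apply: ex_derive; exact: is_derive_wave2.
Qed.

Lemma partial1_wave c a al b be :
  partial 0 (wave c a al b be) = wave (c * a) a (al + pi / 2) b be.
Proof.
apply/funext => -[x y]; rewrite partial_slice1.
by apply: derive_val; exact: is_derive_wave1.
Qed.

Lemma partial2_wave c a al b be :
  partial 1 (wave c a al b be) = wave (c * b) a al b (be + pi / 2).
Proof.
apply/funext => -[x y]; rewrite partial_slice2.
by apply: derive_val; exact: is_derive_wave2.
Qed.

Lemma smooth_wave c a al b be : smooth (wave c a al b be).
Proof.
move=> s /=; suff [c' [al' [be' ->]]] : exists c' al' be',
    foldr partial (wave c a al b be) s = wave c' a al' b be'.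
  by split=> [|i p]; [exact: continuous_wave|exact: derivable_wave].
elim: s => [|i s [c' [al' [be' /= ->]]]]; first by exists c, al, be.
case: (ord2P i) => ->; rewrite ?partial1_wave ?partial2_wave.
  by exists (c' * a), (al' + pi / 2), be'.
by exists (c' * b), al', (be' + pi / 2).
Qed.

Lemma cosDnat2pi (n : nat) x : cos (x + n%:R * (2 * pi)) = cos x :> R.
Proof.
by rewrite !mulr_natl (periodicn (@cosD2pi R)).
Qed.

Lemma wave_periodic c (n : nat) al b be x y :
  wave c n%:R al b be (x + 2 * pi, y) = wave c n%:R al b be (x, y).
Proof. by rewrite /wave/= mulrDr addrAC cosDnat2pi. Qed.

Lemma wave_smooth_on_cylinder c (n : nat) al b be :
  smooth_on_cylinder (wave c n%:R al b be).
Proof. by split; [exact: smooth_wave|exact: wave_periodic]. Qed.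

Lemma smooth_C1 f : smooth f -> C1 f.
Proof.
move=> sf; have [cf df] := sf [::]; split=> // i.
by have [] := sf [:: i].
Qed.

Lemma smooth_partial i f : smooth f -> smooth (partial i f).
Proof.
by move=> sf s; have := sf (rcons s i); rewrite -cats1 foldr_cat.
Qed.

(** The difference quotients of a periodic function are periodic. *)
Lemma smooth_on_cylinder_partial i f :
  smooth_on_cylinder f -> smooth_on_cylinder (partial i f).
Proof.
move=> [sf pf]; split; first exact: smooth_partial.
move=> x y; rewrite /partial /derive.
suff -> : (fun r : R => r^-1 *:
      ((f \o shift (x + 2 * pi, y)) (r *: coord_dir i) - f (x + 2 * pi, y))) =
    (fun r => r^-1 *: ((f \o shift (x, y)) (r *: coord_dir i) - f (x, y))) by [].
apply/funext => r /=; congr (_ *: (_ - _)); last exact: pf.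
by rewrite [X in f X]surjective_pairing [X in _ = f X]surjective_pairing /= addrA pf.
Qed.

End Waves.

(** * Modes and their Green formula *)

Section Modes.
Context {R : realType}.
Variables (lambda mu h : R).
Hypothesis h_gt0 : 0 < h.
Implicit Types (f g : R * R -> R) (x y phi A B Lam : R) (n k : nat).
Notation leb := (@lebesgue_measure R).

(** The vertical wave numbers for which sin (kappa y) vanishes at y = h. *)
Definition freq k : R := k%:R * pi / h.

(** The field (A sin (n x + phi) sin (kappa y), B cos (n x + phi) cos (kappa y))
    with kappa = freq k, written with waves. *)
Definition mode n k phi A B : vfield R := fun a =>
  if a == 0 then wave A n%:R (phi - pi / 2) (freq k) (- (pi / 2))
  else wave B n%:R phi (freq k) 0.

Lemma mode1E n k phi A B p : mode n k phi A B 0 p =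
  A * (sin (n%:R * p.1 + phi) * sin (freq k * p.2)).
Proof. by rewrite /mode/= /wave addrA !cosBpihalf. Qed.

Lemma mode2E n k phi A B p : mode n k phi A B 1 p =
  B * (cos (n%:R * p.1 + phi) * cos (freq k * p.2)).
Proof. by rewrite /mode/= /wave addr0. Qed.

Lemma mode_smooth_on_cylinder n k phi A B a :
  smooth_on_cylinder (mode n k phi A B a).
Proof. by rewrite /mode; case: ifP => _; exact: wave_smooth_on_cylinder. Qed.

Lemma sin_freq k : sin (freq k * h) = 0.
Proof.
rewrite /freq mulfVK ?gt_eqF//; elim: k => [|k IH]; first by rewrite mul0r sin0.
by rewrite -natr1 mulrDl mul1r sinDpi IH oppr0.
Qed.

(** (A, B) is an eigenvector, for the eigenvalue Lam, of the matrix
      | (lambda + 2 mu) n^2 + mu kappa^2     - (lambda + mu) n kappa          |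
      | - (lambda + mu) n kappa              mu n^2 + (lambda + 2 mu) kappa^2 |
    by which the elasticity operator acts on the amplitudes of a mode.  It is
    arranged as minus the divergence of the stress, the form that Green's
    formula produces. *)
Definition eigen_amplitudes n k A B Lam :=
  n%:R * (lambda * (A * n%:R - B * freq k) + 2 * mu * (A * n%:R)) +
    freq k * (mu * (A * freq k - B * n%:R)) = Lam * A /\
  - (n%:R * (mu * (A * freq k - B * n%:R))) -
    freq k * (lambda * (A * n%:R - B * freq k) - 2 * mu * (B * freq k)) = Lam * B.

Section Green.
Variables (n k : nat) (phi A B : R).
Let e : vfield R := mode n k phi A B.
Let De a b := partial b (e a).
Let kap := freq k.
Let S := stress lambda mu De.

Let sigma11 := lambda * (A * n%:R - B * kap) + 2 * mu * (A * n%:R).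
Let sigma22 := lambda * (A * n%:R - B * kap) - 2 * mu * (B * kap).
Let tau := mu * (A * kap - B * n%:R).

Let phaseE := (cosBpihalf, cosDpihalf).

Lemma partial_mode11 : De 0 0 = wave (A * n%:R) n%:R phi kap (- (pi / 2)).
Proof. by rewrite /De /e /mode/= partial1_wave subrK. Qed.

Lemma partial_mode12 : De 0 1 = wave (A * kap) n%:R (phi - pi / 2) kap 0.
Proof. by rewrite /De /e /mode/= partial2_wave addNr. Qed.

Lemma partial_mode21 : De 1 0 = wave (- (B * n%:R)) n%:R (phi - pi / 2) kap 0.
Proof.
rewrite /De /e /mode/= partial1_wave; apply/funext => p.
by rewrite /wave/= /kap !addrA !phaseE; ring.
Qed.

Lemma partial_mode22 : De 1 1 = wave (- (B * kap)) n%:R phi kap (- (pi / 2)).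
Proof.
rewrite /De /e /mode/= partial2_wave; apply/funext => p.
by rewrite /wave/= /kap !addrA !addr0 ?add0r !phaseE; ring.
Qed.

Lemma stress_mode11 : S 0 0 = wave sigma11 n%:R phi kap (- (pi / 2)).
Proof.
apply/funext => p; rewrite /S /stress sum2E partial_mode11 partial_mode22 /wave/=.
by rewrite /sigma11; ring.
Qed.

Lemma stress_mode12 : S 0 1 = wave tau n%:R (phi - pi / 2) kap 0.
Proof.
apply/funext => p; rewrite /S /stress sum2E.
rewrite partial_mode11 partial_mode12 partial_mode21 partial_mode22 /wave/=.
by rewrite /tau; ring.
Qed.

Lemma stress_mode21 : S 1 0 = S 0 1.
Proof. by apply/funext => p; rewrite /S /stress/= [De 1 0 p + _]addrC. Qed.

Lemma stress_mode22 : S 1 1 = wave sigma22 n%:R phi kap (- (pi / 2)).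
Proof.
apply/funext => p; rewrite /S /stress sum2E partial_mode11 partial_mode22 /wave/=.
by rewrite /sigma22; ring.
Qed.

Lemma C1_stress_mode a b : C1 (S a b).
Proof.
by case: (ord2P a) => ->; case: (ord2P b) => ->;
  rewrite ?(stress_mode11, stress_mode21, stress_mode12, stress_mode22);
  apply: smooth_C1; exact: smooth_wave.
Qed.

Lemma periodic_stress_mode a b y : S a b (2 * pi, y) = S a b (0, y).
Proof.
by case: (ord2P a) => ->; case: (ord2P b) => ->;
  rewrite ?(stress_mode11, stress_mode21, stress_mode12, stress_mode22);
  rewrite -[2 * pi]add0r wave_periodic.
Qed.

(** The normal stress contains the factor sin (kappa y). *)
Lemma stress_mode22_bnd x : S 1 1 (x, h) = 0 /\ S 1 1 (x, 0) = 0.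
Proof.
rewrite stress_mode22 /wave/= /kap !cosBpihalf sin_freq.
by split; rewrite ?mulr0 ?sin0 ?mulr0.
Qed.

Lemma div_stress_mode Lam p : eigen_amplitudes n k A B Lam ->
  forall a, partial 0 (S a 0) p + partial 1 (S a 1) p = - (Lam * e a p).
Proof.
move=> [e1 e2] a; case: (ord2P a) => ->.
  rewrite stress_mode11 stress_mode12 partial1_wave partial2_wave.
  rewrite /e mode1E mulrA -e1 /wave/= /kap !addrA ?addr0 !phaseE /sigma11 /tau /kap; ring.
rewrite stress_mode21 stress_mode12 stress_mode22 partial1_wave partial2_wave.
rewrite /e mode2E mulrA -e2 /wave/= /kap !addrA ?addr0 ?subrK /sigma22 /tau /kap; ring.
Qed.

(** Of the boundary terms, those on the vertical sides cancel by periodicity,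
    and that of the normal stress vanishes; there remains the shear stress
    times the tangential component of v.  That component is not assumed to
    vanish, because v will be a smooth approximant of a solution, for which it
    is only small. *)
Lemma green_mode Lam (v : vfield R) : eigen_amplitudes n k A B Lam ->
  (forall a, smooth_on_cylinder (v a)) ->
  cint h (fun p => \sum_(a < 2) \sum_(b < 2) S a b p * partial b (v a) p) =
  \int[leb]_(x in `[0, 2 * pi])
    (S 0 1 (x, h) * v 0 (x, h) - S 0 1 (x, 0) * v 0 (x, 0)) +
  Lam * cint h (fun p => \sum_(a < 2) e a p * v a p).
Proof.
move=> eL sv; have Cv a : C1 (v a) by apply: smooth_C1; case: (sv a).
have pv a y : v a (2 * pi, y) = v a (0, y).
  by rewrite -[2 * pi]add0r (proj2 (sv a)).
have iSv a b := C1_integrable_partialM b h_gt0 (C1_stress_mode a b) (Cv a).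
have ivS a b := C1_integrable_partialM b h_gt0 (Cv a) (C1_stress_mode a b).
have T a b : cint h (fun p => S a b p * partial b (v a) p) =
    cint h (partial b (fun p => S a b p * v a p)) -
    cint h (fun p => v a p * partial b (S a b) p).
  by rewrite cint_partialM ?addrK//; exact: C1_stress_mode.
have T0 a : cint h (partial 0 (fun p => S a 0 p * v a p)) = 0.
  apply: cint_partial1 => //; first exact: C1M (C1_stress_mode a 0) (Cv a).
  by move=> y; rewrite periodic_stress_mode pv.
have T11 : cint h (partial 1 (fun p => S 1 1 p * v 1 p)) = 0.
  rewrite cint_partial2//; last exact: C1M (C1_stress_mode 1 1) (Cv 1).
  rewrite (eq_Rintegral _ (g := fun=> 0)) ?Rintegral_cst ?mul0r// => x _.
  by have [-> ->] := stress_mode22_bnd x; rewrite !mul0r subrr.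
have T01 := cint_partial2 h_gt0 (C1M (C1_stress_mode 0 1) (Cv 0)).
rewrite (cint_sum2 (F := fun a b p => S a b p * partial b (v a) p))//.
have E : \sum_(a < 2) \sum_(b < 2) cint h (fun p => v a p * partial b (S a b) p) =
    - (Lam * cint h (fun p => \sum_(a < 2) e a p * v a p)).
  rewrite -(cint_sum2 (F := fun a b p => v a p * partial b (S a b) p))//.
  have ev a : cintegrable h (fun p => e a p * v a p).
    apply: continuous_integrable_cylinder => // p.
    have [ce _ _] := smooth_C1 (proj1 (mode_smooth_on_cylinder n k phi A B a)).
    by have [cv _ _] := Cv a; exact: continuousM (ce p) (cv p).
  rewrite -mulNr -(cintZ _ (f := fun p => \sum_(a < 2) e a p * v a p)); last first.
    exact: cintegrable_sum.
  apply: eq_cint => p _; rewrite mulr_sumr; apply: eq_bigr => a _.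
  rewrite sum2E; have := div_stress_mode p eL a.
  move: (v a p) (e a p) (partial 0 _ p) (partial 1 _ p) => w u d0 d1 d.
  by rewrite -[LHS]mulrDr d; ring.
rewrite (sum22E (fun a b => cint h (fun p => v a p * partial b (S a b) p))) in E.
rewrite (sum22E (fun a b => cint h (fun p => S a b p * partial b (v a) p))).
(* x, b and c are the three terms of each identity T a b *)
have alg (x00 x01 x10 x11 b00 b01 b10 b11 c00 c01 c10 c11 bd L : R) :
    x00 = b00 - c00 -> x01 = b01 - c01 -> x10 = b10 - c10 -> x11 = b11 - c11 ->
    b00 = 0 -> b01 = bd -> b10 = 0 -> b11 = 0 ->
    c00 + c01 + (c10 + c11) = - L -> x00 + x01 + (x10 + x11) = bd + L.
  by move=> -> -> -> -> -> -> -> -> E'; rewrite -[L]opprK -E'; ring.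
exact: (alg _ _ _ _ _ _ _ _ _ _ _ _ _ _ (T 0 0) (T 0 1) (T 1 0) (T 1 1)
  (T0 0) T01 (T0 1) T11 E).
Qed.

End Green.
End Modes.

(** * Modes are solutions, and solutions are orthogonal to modes *)

Section ModeSolution.
Context {R : realType}.
Variables (lambda mu h : R).
Hypothesis h_gt0 : 0 < h.
Implicit Types (f g : R * R -> R) (x y phi A B Lam : R) (n k : nat) (i : 'I_2).
Notation leb := (@lebesgue_measure R).

Lemma square_integrable_continuous f : continuous f -> square_integrable h f.
Proof.
move=> cf; split.
  by apply: measurable_funTS; exact: continuous_measurable_plane.
apply: (continuous_integrable_cylinder (f := fun p => f p ^+ 2)) => // p.
exact: continuousM (cf p) (cf p).
Qed.

Lemma compact_support_bnd f x : compact_support_inside h f ->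
  f (x, 0) = 0 /\ f (x, h) = 0.
Proof.
move=> [d d0 sf]; split; apply/eqP; apply/negPn/negP => /sf/=; lra.
Qed.

(** A derivative vanishes wherever the function vanishes nearby, and the
    complement of the strip d <= y <= h - d is open. *)
Lemma compact_support_partial i f : compact_support_inside h f ->
  compact_support_inside h (partial i f).
Proof.
move=> [d d0 sf]; exists d => // p; apply: contraNT => out.
suff near0 : \forall q \near p, f q = 0.
  by rewrite /partial (near_eq_derive _ (g := cst 0))// derive_cst.
have op : nbhs p [set q | q.2 < d \/ h - d < q.2].
  apply: open_nbhs_nbhs; split; last first.
    by move: out; rewrite negb_and -!ltNge => /orP[]; [left|right].
  apply: (@openU _ (snd @^-1` [set y | y < d]) (snd @^-1` [set y | h - d < y])).
    apply: (@open_comp _ _ snd); [by move=> q _; exact: cvg_snd|exact: open_lt].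
  apply: (@open_comp _ _ snd); [by move=> q _; exact: cvg_snd|exact: open_gt].
apply: filterS op => q /= qd; apply/eqP; apply/negPn/negP => /sf; case: qd; lra.
Qed.

Lemma cint_weak i f v : C1 f -> (forall y, f (2 * pi, y) = f (0, y)) ->
  smooth_on_cylinder v -> compact_support_inside h v ->
  cint h (fun p => f p * partial i v p) = - cint h (fun p => partial i f p * v p).
Proof.
move=> Cf pf [sv pv] cv.
have Cv := smooth_C1 sv.
rewrite -[in RHS](eq_cint (f := fun p => v p * partial i f p)); last first.
  by move=> p _; rewrite mulrC.
case: (ord2P i) => ->.
  by apply: cint_parts1 => // y; rewrite -[2 * pi]add0r pv.
apply: cint_parts2 => // x.
by have [-> ->] := compact_support_bnd x cv; rewrite !mul0r.
Qed.

Lemma smooth_periodic f y : smooth_on_cylinder f -> f (2 * pi, y) = f (0, y).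
Proof. by move=> [_ pf]; rewrite -[2 * pi]add0r pf. Qed.

(** Integrating by parts twice reverses the order of the two derivatives.  This
    is the order that occurs when the operator is moved from one field to
    another, so the symmetry of second derivatives never enters. *)
Lemma cint_weak2 i j f v : smooth_on_cylinder f ->
  smooth_on_cylinder v -> compact_support_inside h v ->
  cint h (fun p => f p * partial i (partial j v) p) =
  cint h (fun p => partial j (partial i f) p * v p).
Proof.
move=> sf sv cv; have sfi := smooth_on_cylinder_partial i sf.
rewrite cint_weak; first last.
- exact: compact_support_partial.
- exact: smooth_on_cylinder_partial.
- by move=> y; exact: smooth_periodic.
- by apply: smooth_C1; case: sf.
rewrite cint_weak ?opprK//.
- by apply: smooth_C1; case: sfi.
- by move=> y; exact: smooth_periodic.
Qed.

Lemma tangential1 s (w : 'I_2 -> R) : tangential s w 0 = w 0.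
Proof. by rewrite /tangential /normal/= mulr0 subr0. Qed.

Lemma tangential2 s (w : 'I_2 -> R) : tangential s w 1 = 0.
Proof. by rewrite /tangential sum2E /normal/=; case: s; ring. Qed.

Section Mode.
Variables (n k : nat) (phi A B Lam : R).
Hypothesis eL : eigen_amplitudes lambda mu h n k A B Lam.
Let e : vfield R := mode h n k phi A B.
Let De a b := partial b (e a).

Lemma mode1_bnd s x : e 0 (x, height h s) = 0.
Proof. by rewrite /e mode1E; case: s; rewrite /height/= ?sin_freq ?mulr0 ?sin0 ?mulr0. Qed.

Lemma continuous_mode a : continuous (e a).
Proof. by have [] := smooth_C1 (proj1 (mode_smooth_on_cylinder h n k phi A B a)). Qed.

Lemma continuous_grad_mode a b : continuous (De a b).
Proof. by have [_ _ +] := smooth_C1 (proj1 (mode_smooth_on_cylinder h n k phi A B a)); apply. Qed.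

Lemma mode_in_H1 : in_H1 h e De.
Proof.
split=> [a|a b]; first exact: square_integrable_continuous (@continuous_mode a).
split; first exact: square_integrable_continuous (@continuous_grad_mode a b).
have sa := mode_smooth_on_cylinder h n k phi A B a.
move=> v sv cv; apply: cint_weak => //; first exact: smooth_C1 (proj1 sa).
by move=> y; exact: smooth_periodic.
Qed.

(** Test fields normal to the boundary kill the boundary term of Green's
    formula. *)
Lemma mode_normal_traction : normal_traction_zero lambda mu h De (fun a p => Lam * e a p).
Proof.
move=> v sv tv; have v0 s x : v 0 (x, height h s) = 0 by have := tv s 0 x; rewrite tangential1.
rewrite /traction_pairing -/(cint h _) -/(cint h _).
rewrite (green_mode h_gt0 phi eL sv) (eq_Rintegral _ (g := fun=> 0)); last first.
  by move=> x _; have -> := v0 true x; have -> := v0 false x; rewrite !mulr0 subrr.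
rewrite Rintegral_cst ?mul0r// add0r -cintZ; last first.
  apply: cintegrable_sum => a; apply: continuous_integrable_cylinder => // p.
  have [cv _ _] := smooth_C1 (proj1 (sv a)).
  exact: continuousM (@continuous_mode a p) (cv p).
apply/eqP; rewrite subr_eq0; apply/eqP; apply: eq_cint => p _.
by rewrite mulr_sumr; apply: eq_bigr => a _; rewrite mulrA.
Qed.

(** A mode is smooth, hence approximated by itself. *)
Lemma mode_tangential_trace : tangential_trace_zero h e De.
Proof.
exists (fun=> e); split.
- by move=> _ a; exact: mode_smooth_on_cylinder.
- move=> a; rewrite (_ : (fun=> _) = cst 0); first exact: cvg_cst.
  apply/funext => m; apply: etrans (cint0 h); apply: eq_cint => p _.
  by rewrite subrr expr0n.
- move=> a b; rewrite (_ : (fun=> _) = cst 0); first exact: cvg_cst.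
  apply/funext => m; apply: etrans (cint0 h); apply: eq_cint => p _.
  by rewrite subrr expr0n.
- move=> s a; rewrite (_ : (fun=> _) = cst 0); first exact: cvg_cst.
  apply/funext => m; rewrite (eq_Rintegral _ (g := fun=> 0)) ?Rintegral_cst ?mul0r//.
  move=> x _; case: (ord2P a) => ->; rewrite ?tangential1 ?tangential2.
    by rewrite mode1_bnd expr0n.
  by rewrite expr0n.
Qed.

(** The operator applied to a mode, with each mixed derivative in the order that
    cint_weak2 yields. *)
Lemma elasticity_mode p :
  - mu * (partial 0 (De 0 0) p + partial 1 (De 0 1) p)
    - (lambda + mu) * (partial 0 (De 0 0) p + partial 0 (De 1 1) p) = Lam * e 0 p /\
  - mu * (partial 0 (De 1 0) p + partial 1 (De 1 1) p)
    - (lambda + mu) * (partial 1 (De 0 0) p + partial 1 (De 1 1) p) = Lam * e 1 p.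
Proof.
have [e1 e2] := eL.
rewrite /De /e partial_mode11 partial_mode12 partial_mode21 partial_mode22.
rewrite !partial1_wave !partial2_wave mode1E mode2E.
split; rewrite mulrA -?e1 -?e2 /wave/= !addrA ?subrK ?addNr ?addr0 ?(cosBpihalf, cosDpihalf).
  move: (sin _) (sin _) => u w; ring.
move: (cos _) (cos _) => u w; ring.
Qed.

Lemma mode_weak_elasticity : weak_elasticity lambda mu h e (fun a p => Lam * e a p).
Proof.
move=> v sv cv; rewrite -/(cint h _) -/(cint h _).
have Cv a : C1 (v a) := smooth_C1 (proj1 (sv a)).
have Cvi a b : C1 (partial b (v a)) := smooth_C1 (smooth_partial b (proj1 (sv a))).
have ce := continuous_mode.
have iE a b c d : cintegrable h (fun p => e a p * partial b (partial c (v d)) p).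
  apply: continuous_integrable_cylinder => // p.
  by have [_ _ cvb] := Cvi d c; exact: continuousM (ce a p) (cvb b p).
have w2 a b c d : cint h (fun p => e a p * partial b (partial c (v d)) p) =
    cint h (fun p => partial c (partial b (e a)) p * v d p).
  by apply: cint_weak2 => //; exact: mode_smooth_on_cylinder.
have i2 a b c d : cintegrable h (fun p => partial c (partial b (e a)) p * v d p).
  apply: continuous_integrable_cylinder => // p.
  have [_ _ cce] := smooth_C1 (smooth_partial b (proj1 (mode_smooth_on_cylinder h n k phi A B a))).
  by have [cvd _ _] := Cv d; exact: continuousM (cce c p) (cvd p).
pose F a b p := e a p * partial b (partial b (v a)) p.
pose G a b p := e a p * partial a (partial b (v b)) p.
pose F' a b p := partial b (partial b (e a)) p * v a p.
pose G' a b p := partial b (partial a (e a)) p * v b p.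
have divE a p : partial a (div v) p = \sum_(b < 2) partial a (partial b (v b)) p.
  by rewrite sum2E -partialD//; congr (partial a _ p); apply/funext => q; rewrite /div sum2E.
transitivity (- mu * cint h (fun p => \sum_(a < 2) \sum_(b < 2) F a b p)
   - (lambda + mu) * cint h (fun p => \sum_(a < 2) \sum_(b < 2) G a b p)).
  rewrite -cintZ; last by do 2 (apply: cintegrable_sum => ?); exact: iE.
  rewrite -cintZ; last by do 2 (apply: cintegrable_sum => ?); exact: iE.
  rewrite -cintB; first last.
  - by apply: cintegrableZ; do 2 (apply: cintegrable_sum => ?); exact: iE.
  - by apply: cintegrableZ; do 2 (apply: cintegrable_sum => ?); exact: iE.
  apply: eq_cint => p _; rewrite !mulr_sumr -sumrB; apply: eq_bigr => a _.
  rewrite /elasticity divE mulrBr !mulr_sumr; congr (_ - _);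
    by apply: eq_bigr => b _; rewrite mulrCA.
have FF : cint h (fun p => \sum_(a < 2) \sum_(b < 2) F a b p) =
    cint h (fun p => \sum_(a < 2) \sum_(b < 2) F' a b p).
  rewrite (cint_sum2 (F := F)); last by move=> a b; exact: iE.
  rewrite (cint_sum2 (F := F')); last by move=> a b; exact: i2.
  by apply: eq_bigr => a _; apply: eq_bigr => b _; exact: w2.
have GG : cint h (fun p => \sum_(a < 2) \sum_(b < 2) G a b p) =
    cint h (fun p => \sum_(a < 2) \sum_(b < 2) G' a b p).
  rewrite (cint_sum2 (F := G)); last by move=> a b; exact: iE.
  rewrite (cint_sum2 (F := G')); last by move=> a b; exact: i2.
  by apply: eq_bigr => a _; apply: eq_bigr => b _; exact: w2.
apply: etrans (congr2 (fun u w => - mu * u - (lambda + mu) * w) FF GG) _.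
rewrite -cintZ; last by do 2 (apply: cintegrable_sum => ?); exact: i2.
rewrite -cintZ; last by do 2 (apply: cintegrable_sum => ?); exact: i2.
rewrite -cintB; first last.
- by apply: cintegrableZ; do 2 (apply: cintegrable_sum => ?); exact: i2.
- by apply: cintegrableZ; do 2 (apply: cintegrable_sum => ?); exact: i2.
apply: eq_cint => p _; rewrite (sum22E (fun a b => F' a b p)) (sum22E (fun a b => G' a b p)) sum2E.
have [E1 E2] := elasticity_mode p.
have alg (m l u00 u01 u10 u11 w00 w01 w10 w11 z0 z1 c0 c1 : R) :
    - m * (u00 + u01) - l * (u00 + w01) = c0 ->
    - m * (u10 + u11) - l * (w10 + u11) = c1 ->
    - m * (u00 * z0 + u01 * z0 + (u10 * z1 + u11 * z1)) -
      l * (u00 * z0 + w10 * z1 + (w01 * z0 + u11 * z1)) = c0 * z0 + c1 * z1.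
  by move=> <- <-; ring.
exact: alg E1 E2.
Qed.

Lemma mode_DF_solution : DF_solution lambda mu h Lam e.
Proof.
exists De; split; [exact: mode_in_H1|exact: mode_weak_elasticity|
  exact: mode_tangential_trace|exact: mode_normal_traction].
Qed.

Definition inner (u w : vfield R) : R := cint h (fun p => \sum_(a < 2) u a p * w a p).

(** The symmetric bilinear form of elastic energy is evaluated on (u, e) in two
    ways: by the traction condition of u with the test field e, and by Green's
    formula for e with the smooth approximants v m of u, in the limit. *)
Lemma solution_mode_orthogonal Lam' u : DF_solution lambda mu h Lam' u ->
  (Lam' - Lam) * inner u e = 0.
Proof.
move=> [Du [[L2u H1u] _ [v [sv vu vDu vbd]] nt]].
have L2Du a b : square_integrable h (Du a b) by have [] := H1u a b.
have L2e a : square_integrable h (e a).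
  exact: square_integrable_continuous (@continuous_mode a).
have L2De a b : square_integrable h (De a b).
  exact: square_integrable_continuous (@continuous_grad_mode a b).
have L2v m a : square_integrable h (v m a).
  by apply: square_integrable_continuous; have [] := smooth_C1 (proj1 (sv m a)).
have L2Dv m a b : square_integrable h (partial b (v m a)).
  by apply: square_integrable_continuous; have [_ _] := smooth_C1 (proj1 (sv m a)); exact.
pose S := stress lambda mu De.
have CS a b : C1 (S a b) := @C1_stress_mode R lambda mu h n k phi A B a b.
have L2S a b : square_integrable h (S a b).
  by apply: square_integrable_continuous; have [] := CS a b.
have mD := cylinder_measurable h.
have iM f g : square_integrable h f -> square_integrable h g ->
    cintegrable h (fun p => f p * g p).
  by move=> Lf Lg; exact: (L2M mD Lf Lg).
have cvM (w : nat -> R * R -> R) f g : (forall m, square_integrable h (w m)) ->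
    square_integrable h f -> square_integrable h g ->
    cint h (fun p => (w m p - f p) ^+ 2) @[m --> \oo] --> (0 : R) ->
    cint h (fun p => w m p * g p) @[m --> \oo] --> cint h (fun p => f p * g p).
  by move=> Lw Lf Lg wf; exact: (cvg_int_mul mD Lw Lf Lg wf).
(* the right-hand side of Green's formula for v m converges *)
have limit1 : inner (v m) e @[m --> \oo] --> inner u e.
  have innerE w : (forall a, square_integrable h (w a)) ->
      inner w e = \sum_(a < 2) cint h (fun p => w a p * e a p).
    by move=> Lw; apply: (cint_sum (F := fun a p => w a p * e a p)) => a; exact: iM.
  rewrite innerE// (_ : (fun m => _) =
    fun m => \sum_(a < 2) cint h (fun p => v m a p * e a p)); last first.
    by apply/funext => m; exact: innerE.
  rewrite sum2E; under eq_fun do rewrite sum2E.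
  apply: cvgD; (apply: cvM; [move=> m; exact: L2v|exact: L2u|exact: L2e|exact: vu]).
(* so does its left-hand side, the energy of (v m, e) *)
have limit2 : cint h (fun p => \sum_(a < 2) \sum_(b < 2) S a b p * partial b (v m a) p)
    @[m --> \oo] --> cint h (fun p => \sum_(a < 2) \sum_(b < 2) S a b p * Du a b p).
  rewrite (cint_sum2 (F := fun a b p => S a b p * Du a b p)) => [|a b]; last exact: iM.
  rewrite (_ : (fun m => _) = fun m => \sum_(a < 2) \sum_(b < 2)
      cint h (fun p => S a b p * partial b (v m a) p)); last first.
    apply/funext => m.
    by apply: (cint_sum2 (F := fun a b p => S a b p * partial b (v m a) p)) => a b; exact: iM.
  have lim a b : cint h (fun p => S a b p * partial b (v m a) p) @[m --> \oo] -->
      cint h (fun p => S a b p * Du a b p).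
    rewrite (_ : (fun m => _) =
      fun m => cint h (fun p => partial b (v m a) p * S a b p)); last first.
      by apply/funext => m; apply: eq_cint => p _; rewrite mulrC.
    rewrite (_ : cint h _ = cint h (fun p => Du a b p * S a b p)); last first.
      by apply: eq_cint => p _; rewrite mulrC.
    by apply: cvM; [move=> m; exact: L2Dv|exact: L2Du|exact: L2S|exact: vDu].
  rewrite (sum22E (fun a b => cint h (fun p => S a b p * Du a b p))).
  rewrite (_ : (fun m => _) = (fun m =>
    cint h (fun p => S 0 0 p * partial 0 (v m 0) p) +
    cint h (fun p => S 0 1 p * partial 1 (v m 0) p) +
    (cint h (fun p => S 1 0 p * partial 0 (v m 1) p) +
     cint h (fun p => S 1 1 p * partial 1 (v m 1) p)))); last first.
    apply/funext => m.
    exact: (sum22E (fun a b => cint h (fun p => S a b p * partial b (v m a) p))).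
  by apply: cvgD; apply: cvgD; exact: lim.
(* the boundary term tends to 0, since the tangential boundary values of v m do *)
have limit3 : \int[leb]_(x in `[0, 2 * pi]) (S 0 1 (x, h) * v m 0 (x, h) -
    S 0 1 (x, 0) * v m 0 (x, 0)) @[m --> \oo] --> (0 : R).
  have L2c (g : R -> R) : continuous g -> L2 leb `[0, 2 * pi]%classic g.
    move=> cg; split; first by apply: measurable_funTS; exact: continuous_measurable_fun.
    apply: (continuous_compact_integrable (f := fun x => g x ^+ 2)).
      exact: segment_compact.
    by apply: continuous_subspaceT => x; exact: continuousM (cg x) (cg x).
  have L2b f y : C1 f -> L2 leb `[0, 2 * pi]%classic (fun x => f (x, y)).
    by move=> [cf _ _]; apply: L2c; exact: continuous_slice1.
  have lim s : \int[leb]_(x in `[0, 2 * pi]) (v m 0 (x, height h s) * S 0 1 (x, height h s))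
      @[m --> \oo] --> (0 : R).
    have Z : \int[leb]_(x in `[0, 2 * pi]) (0 * S 0 1 (x, height h s)) = 0.
      by rewrite (eq_Rintegral _ (g := fun=> 0)) ?Rintegral_cst ?mul0r// => x _; rewrite mul0r.
    rewrite -[X in _ --> X]Z.
    apply: (@cvg_int_mul _ _ _ leb `[0, 2 * pi]%classic (measurable_itv _)
      (fun m x => v m 0 (x, height h s)) (fun=> 0) (fun x => S 0 1 (x, height h s))).
    - by move=> m; apply: L2b; exact: smooth_C1 (proj1 (sv m 0)).
    - by apply: L2c => x; exact: cvg_cst.
    - exact: L2b.
    - have := vbd s 0; apply: cvg_trans; apply: near_eq_cvg; near=> m.
      by apply: eq_Rintegral => x _; rewrite tangential1 subr0.
  rewrite -[X in _ --> X](subrr (0 : R)).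
  rewrite (_ : (fun m => _) = fun m =>
    \int[leb]_(x in `[0, 2 * pi]) (v m 0 (x, height h true) * S 0 1 (x, height h true)) -
    \int[leb]_(x in `[0, 2 * pi]) (v m 0 (x, height h false) * S 0 1 (x, height h false))).
    exact: cvgB (lim true) (lim false).
  apply/funext => m; rewrite -RintegralB//; last 2 first.
  - by apply: L2M => //; apply: L2b => //; exact: smooth_C1 (proj1 (sv m 0)).
  - by apply: L2M => //; apply: L2b => //; exact: smooth_C1 (proj1 (sv m 0)).
  by apply: eq_Rintegral => x _; rewrite /height ![v m 0 _ * _]mulrC.
(* e is normal to the boundary, hence a legitimate test field for the traction of u *)
have test : cint h (fun p => \sum_(a < 2) \sum_(b < 2) S a b p * Du a b p) =
    Lam' * inner u e.
  have te s a x : tangential s (fun b => e b (x, height h s)) a = 0.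
    by case: (ord2P a) => ->; rewrite ?tangential1 ?tangential2 ?mode1_bnd.
  have := nt e (fun a => mode_smooth_on_cylinder h n k phi A B a) te.
  rewrite /traction_pairing -/(cint h _) -/(cint h _) => /eqP; rewrite subr_eq0 => /eqP E.
  rewrite /inner -cintZ; last by apply: cintegrable_sum => a; exact: iM.
  rewrite (_ : cint h (fun p => Lam' * _) =
    cint h (fun p => \sum_(a < 2) Lam' * u a p * e a p)); last first.
    by apply: eq_cint => p _; rewrite mulr_sumr; apply: eq_bigr => a _; rewrite mulrA.
  rewrite -E; apply: eq_cint => p _.
  rewrite (sum22E (fun a b => S a b p * Du a b p)).
  rewrite (sum22E (fun a b => stress lambda mu Du a b p * partial b (e a) p)).
  rewrite /S /stress !sum2E -!/(De _ _ p) /=.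
  (* symmetry of the energy density in the two gradients *)
  move: (De 0 0 p) (De 0 1 p) (De 1 0 p) (De 1 1 p) => a00 a01 a10 a11.
  move: (Du 0 0 p) (Du 0 1 p) (Du 1 0 p) (Du 1 1 p) => b00 b01 b10 b11.
  by ring.
have G m := green_mode h_gt0 phi eL (sv m).
have E : cint h (fun p => \sum_(a < 2) \sum_(b < 2) S a b p * Du a b p) =
    0 + Lam * inner u e.
  apply: cvg_unique limit2 _; first exact: Rhausdorff.
  rewrite (_ : (fun m => _) = fun m =>
    \int[leb]_(x in `[0, 2 * pi]) (S 0 1 (x, h) * v m 0 (x, h) -
      S 0 1 (x, 0) * v m 0 (x, 0)) + Lam * inner (v m) e).
    exact: cvgD limit3 (cvgM (cvg_cst Lam) limit1).
  apply/funext => m; rewrite [LHS]G; congr (_ + Lam * _); apply: eq_cint => p _.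
  by apply: eq_bigr => a _; rewrite mulrC.
by rewrite mulrBl -test E add0r subrr.
Unshelve. all: by end_near.
Qed.

End Mode.
End ModeSolution.

(** * Polynomials converging to a step function *)

Section KuhnPolynomials.
Context {R : realType}.
Implicit Types (x t : R) (n N : nat).

(** Bernoulli's inequality, on the whole half-line x <= 1: where the left-hand
    side is negative there is nothing to prove. *)
Lemma bernoulli_ge x N : x <= 1 -> 1 - N%:R * x <= (1 - x) ^+ N.
Proof.
move=> x1; elim: N => [|N IH]; first by rewrite mul0r subr0 expr0.
rewrite exprS; have [Nx1|Nx1] := leP (N%:R * x) 1.
  have : (1 - x) * (1 - N%:R * x) <= (1 - x) * (1 - x) ^+ N.
    by rewrite ler_wpM2l// subr_ge0.
  apply: le_trans; rewrite -natr1.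
  have -> : (1 - x) * (1 - N%:R * x) = 1 - (N%:R + 1) * x + N%:R * x ^+ 2 by ring.
  by rewrite lerDl mulr_ge0 ?sqr_ge0.
have x0 : 0 <= x.
  rewrite leNgt; apply/negP => x0; move: Nx1.
  by rewrite ltNge (le_trans _ ler01)// mulr_ge0_le0// ltW.
apply: (@le_trans _ _ 0).
  by rewrite subr_le0 -natr1 mulrDl mul1r (le_trans (ltW Nx1))// lerDl.
by rewrite mulr_ge0 ?exprn_ge0 ?subr_ge0.
Qed.

(** Bernoulli's inequality for - x, together with (1 - x) (1 + x) <= 1. *)
Lemma bernoulli_le x N : 0 <= x <= 1 -> (1 - x) ^+ N * (1 + N%:R * x) <= 1.
Proof.
move=> /andP[x0 x1]; have : 1 - N%:R * (- x) <= (1 - (- x)) ^+ N.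
  by apply: bernoulli_ge; rewrite lerNl (le_trans _ x0)// lerN10.
rewrite mulrN opprK opprK => /(ler_wpM2l (exprn_ge0 N (_ : 0 <= 1 - x))) H.
apply: le_trans (H _) _; first by rewrite subr_ge0.
rewrite -exprMn; apply: exprn_ile1.
  by rewrite mulr_ge0 ?subr_ge0// addr_ge0.
by rewrite -subr_sqr expr1n gerBl sqr_ge0.
Qed.

(** With s the square root of x, Bernoulli's inequality for 1 / s bounds n s^n,
    and the remaining factor s^n tends to 0. *)
Lemma cvg_natr_expr x : 0 <= x < 1 -> n%:R * x ^+ n @[n --> \oo] --> (0 : R).
Proof.
move=> /andP[x0 x1]; have [->|xneq0] := eqVneq x 0.
  rewrite (_ : (fun n => _) = cst 0); first exact: cvg_cst.
  by apply/funext => -[|n]; rewrite ?mul0r// expr0n mulr0.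
pose s := Num.sqrt x; have s0 : 0 < s by rewrite sqrtr_gt0 lt_neqAle eq_sym xneq0.
have s1 : s < 1 by rewrite -sqrtr1 ltr_sqrt.
have xs : x = s * s by rewrite -expr2 sqr_sqrtr.
pose d := s^-1 - 1; have d0 : 0 < d by rewrite subr_gt0 invf_gt1.
have bound n : n%:R * x ^+ n <= d^-1 * s ^+ n.
  rewrite xs exprMn mulrA; apply: ler_wpM2r; first by rewrite exprn_ge0 ?ltW.
  rewrite -[leRHS]mulr1 ler_pdivlMl//.
  have := @bernoulli_ge (- d) n; rewrite mulrN !opprK => /(_ _)/wrap[]; first lra.
  have -> : 1 + d = s^-1 by rewrite addrC subrK.
  rewrite exprVn => H; have sn : 0 < s ^+ n by exact: exprn_gt0.
  have : (1 + n%:R * d) * s ^+ n <= 1.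
    by rewrite -[leRHS](mulVf (lt0r_neq0 sn)) ler_pM2r.
  have -> : (1 + n%:R * d) * s ^+ n = s ^+ n + d * (n%:R * s ^+ n) by ring.
  by apply: le_trans; rewrite lerDr ltW.
apply: (@squeeze_cvgr _ _ _ _ (cst 0) (fun n => d^-1 * s ^+ n)).
- by near=> n; rewrite bound andbT mulr_ge0 ?exprn_ge0.
- exact: cvg_cst.
- rewrite -[X in _ --> X](mulr0 d^-1); apply: cvgM; first exact: cvg_cst.
  by apply: cvg_expr; rewrite ger0_norm ?ltW.
Unshelve. all: by end_near.
Qed.

(** Kuhn's polynomials.  The exponent 2^n would already separate t < 1/2 from
    t > 1/2; the factor n makes the values at t = 1/2 tend to 0 as well, so that
    the limit is the step function everywhere on [0, 1]. *)
Definition kuhn n t : R := (1 - t ^+ n) ^+ (n * 2 ^ n).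

Lemma kuhn_itv n t : 0 <= t <= 1 -> 0 <= kuhn n t <= 1.
Proof.
move=> /andP[t0 t1]; have tn0 : 0 <= t ^+ n by exact: exprn_ge0.
have tn1 : t ^+ n <= 1 by exact: exprn_ile1.
by rewrite exprn_ge0 ?subr_ge0// exprn_ile1 ?subr_ge0// gerBl.
Qed.

(** With N = n 2^n one has N t^n = n (2 t)^n, which tends to 0 for t < 1/2 and
    is at least n for t >= 1/2.  The two Bernoulli inequalities conclude. *)
Lemma cvg_kuhn t : 0 <= t <= 1 -> kuhn n t @[n --> \oo] --> ((t < 2^-1)%R%:R : R).
Proof.
move=> tI; have /andP[t0 t1] := tI.
have E n : (n * 2 ^ n)%:R * t ^+ n = n%:R * (2 * t) ^+ n by rewrite natrM natrX exprMn mulrA.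
have [t2|t2] := ltP t 2^-1.
  apply: (@squeeze_cvgr _ _ _ _ (fun n => 1 - n%:R * (2 * t) ^+ n) (cst 1)).
  - near=> n; rewrite (andP (kuhn_itv n tI)).2 andbT -E.
    by apply: bernoulli_ge; exact: exprn_ile1.
  - rewrite -[X in _ --> X]subr0; apply: cvgB; first exact: cvg_cst.
    by apply: cvg_natr_expr; apply/andP; split; lra.
  - exact: cvg_cst.
apply: (@squeeze_cvgr _ _ _ _ (cst 0) (fun n => n.+1%:R^-1)).
- near=> n; rewrite (andP (kuhn_itv n tI)).1/=.
  have tnI : 0 <= t ^+ n <= 1 by rewrite exprn_ge0//= exprn_ile1.
  have := bernoulli_le (n * 2 ^ n) tnI; rewrite -/(kuhn n t) E => H.
  rewrite -[leRHS]mul1r ler_pdivlMr ?ltr0n//.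
  apply: le_trans H; apply: ler_wpM2l; first by have /andP[] := kuhn_itv n tI.
  rewrite -natr1 addrC lerD2l -[leLHS]mulr1 ler_wpM2l// exprn_ege1//; lra.
- exact: cvg_cst.
- exact: cvg_harmonic.
Unshelve. all: by end_near.
Qed.

End KuhnPolynomials.

(** * From moments to integrals over measurable sets *)

Section MomentThreshold.
Context d (T : measurableType d) (R : realType) (mu : {measure set T -> \bar R}).
Variables (D : set T) (mD : measurable D) (f g : T -> R) (c : R).
Hypothesis if_ : mu.-integrable D (EFin \o f).
Hypothesis mg : measurable_fun D g.
Hypothesis g1 : forall x, D x -> `|g x| <= 1.
Hypothesis c1 : `|c| <= 1.
Hypothesis moments : forall j : nat, \int[mu]_(x in D) (f x * g x ^+ j) = 0.

Lemma integrableM_bounded (u : T -> R) M : measurable_fun D u ->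
  (forall x, D x -> `|u x| <= M) ->
  mu.-integrable D (EFin \o (fun x => f x * u x)).
Proof.
move=> mu_ uM; have mf : measurable_fun D f.
  by apply/measurable_EFinP; exact: measurable_int if_.
apply: (le_integrable mD (g := EFin \o (fun x => M * f x))).
- by apply/measurable_EFinP; exact: measurable_funM.
- move=> x Dx; rewrite /= lee_fin !normrM mulrC ler_wpM2r//.
  exact: le_trans (uM x Dx) (ler_norm M).
- exact: (integrableZl mD M if_).
Qed.

(** By induction on the polynomial, with a power of g as a parameter: the step
    P |-> P X + a raises that power by one. *)
Lemma integral_horner (P : {poly R}) : \int[mu]_(x in D) (f x * P.[g x]) = 0.
Proof.
have mgX n : measurable_fun D (fun x => g x ^+ n) by exact: measurable_funX.
have g1X n x : D x -> `|g x ^+ n| <= 1.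
  by move=> Dx; rewrite normrX exprn_ile1// g1.
have igX n : mu.-integrable D (EFin \o (fun x => f x * g x ^+ n)).
  exact: integrableM_bounded (mgX n) (g1X n).
suff main j :
    mu.-integrable D (EFin \o (fun x => f x * (P.[g x] * g x ^+ j))) /\
    \int[mu]_(x in D) (f x * (P.[g x] * g x ^+ j)) = 0.
  rewrite -[RHS](main 0%N).2; apply: eq_Rintegral => x _.
  by rewrite expr0 mulr1.
elim/poly_ind: P j => [|P a IH] j.
  have E : (fun x => f x * ((0 : {poly R}).[g x] * g x ^+ j)) = fun=> 0.
    by apply/funext => x; rewrite horner0 mul0r mulr0.
  rewrite E; split; first exact: integrable0.
  by rewrite Rintegral_cst ?mul0r.
have E x : f x * ((P * 'X + a%:P).[g x] * g x ^+ j) =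
    f x * (P.[g x] * g x ^+ j.+1) + a * (f x * g x ^+ j).
  by rewrite hornerMXaddC exprS; ring.
have [IH1 IH2] := IH j.+1.
have i2 : mu.-integrable D (EFin \o (fun x => a * (f x * g x ^+ j))).
  exact: (integrableZl mD a (igX j)).
split.
  have := integrableD mD IH1 i2; apply: eq_integrable => // x _.
  by rewrite /= -EFinD -E.
rewrite (eq_Rintegral _ (g := fun x =>
  f x * (P.[g x] * g x ^+ j.+1) + a * (f x * g x ^+ j))); last by move=> x _; exact: E.
by rewrite RintegralD// IH2 RintegralZl// moments mulr0 addr0.
Qed.

(** The affine map s sends [-1, 1] into [0, 1] and c to 1/2.  Kuhn's polynomials
    at s (g x) are polynomials in g x; they are bounded by 1 and converge to the
    indicator of g < c, so that dominated convergence applies. *)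
Lemma integral_threshold : \int[mu]_(x in D `&` [set x | g x < c]) f x = 0.
Proof.
pose s x := 2^-1 + (g x - c) / 4.
have s01 x : D x -> 0 <= s x <= 1.
  move=> Dx; have := g1 Dx; move: c1; rewrite !ler_norml => /andP[c_ge c_le] /andP[g_ge g_le].
  by rewrite /s; apply/andP; split; lra.
have sc x : (s x < 2^-1) = (g x < c).
  by rewrite /s -[ltRHS]addr0 ltrD2l pmulr_llt0 ?invr_gt0// subr_lt0.
pose P n : {poly R} := (1 - ((2^-1)%:P + 4^-1 *: ('X - c%:P)) ^+ n) ^+ (n * 2 ^ n).
have PE n x : (P n).[g x] = kuhn n (s x).
  by rewrite /P /kuhn !hornerE/= /s [_ / 4]mulrC.
have ms : measurable_fun D s.
  apply: measurable_funD => //; apply: measurable_funM => //.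
  exact: measurable_funB.
have mk n : measurable_fun D (fun x => kuhn n (s x)).
  by rewrite /kuhn; apply: measurable_funX; apply: measurable_funB => //; exact: measurable_funX.
have mf : measurable_fun D f by apply/measurable_EFinP; exact: measurable_int if_.
have k1 n x : D x -> `|kuhn n (s x)| <= 1.
  by move=> Dx; have /andP[k0 k1] := kuhn_itv n (s01 x Dx); rewrite ger0_norm.
have lim x : D x -> f x * kuhn n (s x) @[n --> \oo] --> f x * (g x < c)%R%:R.
  by move=> Dx; apply: cvgM; [exact: cvg_cst|rewrite -sc; exact: cvg_kuhn (s01 x Dx)].
have mlim : measurable_fun D (fun x => f x * (g x < c)%R%:R).
  by apply: (measurable_fun_cvg _ lim) => n; exact: measurable_funM.
have [||||| _ _] := @dominated_convergence _ _ _ mu D mD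
  (fun n x => (f x * kuhn n (s x))%:E) (fun x => (f x * (g x < c)%R%:R)%:E)
  (fun x => `|f x|%:E).
- by move=> n; apply/measurable_EFinP; exact: measurable_funM.
- exact/measurable_EFinP.
- by apply: aeW => x Dx; apply: cvg_EFin; [exact: nearW|exact: lim].
- exact: integrable_norm if_.
- apply: aeW => x n Dx; rewrite /= lee_fin normrM -[leRHS]mulr1 ler_wpM2l//.
  exact: k1.
set I := (X in _ --> X) => cvI.
have I0 : I = 0%E.
  apply: cvg_unique cvI _; first exact: ereal_hausdorff.
  rewrite (_ : (fun n => _) = cst 0%E); first exact: cvg_cst.
  apply/funext => n /=.
  have := integral_horner (P n).
  rewrite (eq_Rintegral _ (g := fun x => f x * kuhn n (s x))) => [R0|x _]; last by rewrite PE.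
  rewrite -[RHS]/(0%R)%:E -R0 /Rintegral fineK//.
  apply: integrable_fin_num => //.
  exact: integrableM_bounded (mk n) (k1 n).
rewrite Rintegral_mkcondr; rewrite /I in I0.
rewrite /Rintegral -[RHS]/(fine 0%E) -I0; congr fine; apply: eq_integral => x _.
rewrite patchE (_ : (x \in [set x | g x < c]) = (g x < c)).
  by case: (g x < c); rewrite ?mulr1 ?mulr0.
by apply/idP/idP; rewrite inE.
Qed.

End MomentThreshold.

Section IntegralDynkin.
Context d (T : measurableType d) (R : realType) (mu : {measure set T -> \bar R}).
Context d' (U : measurableType d') (G : set (set U)).
Hypothesis genG : @measurable _ U = <<s G >>.
Hypothesis GI : setI_closed G.
Variables (D : set T) (mD : measurable D) (f : T -> R) (proj : T -> U).
Hypothesis if_ : mu.-integrable D (EFin \o f).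
Hypothesis mproj : measurable_fun setT proj.

(** The sets over whose preimage f integrates to 0 form a Dynkin system; the
    projection allows one coordinate of the plane to be treated at a time. *)
Lemma integral0_dynkin :
  \int[mu]_(x in D) f x = 0 ->
  (forall A, G A -> \int[mu]_(x in D `&` proj @^-1` A) f x = 0) ->
  forall A, measurable A -> \int[mu]_(x in D `&` proj @^-1` A) f x = 0.
Proof.
move=> D0 G0 A; rewrite genG; move: A.
have mpA A : measurable A -> measurable (D `&` proj @^-1` A).
  by move=> mA; apply: measurableI => //; rewrite -[X in measurable X]setTI; exact: mproj.
have iS S : measurable S -> mu.-integrable (D `&` proj @^-1` S) (EFin \o f).
  by move=> mS; apply: integrableS if_ => //; exact: mpA.
apply: (@dynkin_induction _ U G (fun A => \int[mu]_(x in D `&` proj @^-1` A) f x = 0)) => //.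
- by rewrite preimage_setT setIT.
- move=> S mS PS; have mSC := measurableC mS.
  have E : D = D `&` proj @^-1` S `|` D `&` proj @^-1` (~` S).
    by rewrite -setIUr -preimage_setU setUv preimage_setT setIT.
  have := Rintegral_setU (f := f) (mpA _ mS) (mpA _ mSC).
  rewrite -E => /(_ mu if_); rewrite D0 PS add0r => <- //.
  rewrite disj_set2E; apply/eqP; rewrite setIACA setIid -preimage_setI setICr.
  by rewrite preimage_set0 setI0.
- move=> F mF tF F0; rewrite preimage_bigcup setI_bigcupr.
  rewrite /Rintegral integral_bigcup.
  + rewrite eseries0// => k _ _; rewrite -[RHS]/(0%R)%:E -[in RHS](F0 k) fineK//.
    by apply: integrable_fin_num; [exact: mpA|exact: iS].
  + apply: trivIset_setIl => i j _ _ [x [Fi Fj]].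
    by apply: tF => //; exists (proj x).
  + by move=> k; exact: mpA.
  + by rewrite -setI_bigcupr -preimage_bigcup; apply: iS; exact: bigcup_measurable.
Qed.

End IntegralDynkin.

(** * Completeness of the Fourier systems *)

Section Uniqueness.
Context {R : realType}.
Variable h : R.
Hypothesis h_gt0 : 0 < h.
Implicit Types (f g : R * R -> R) (x y : R).
Notation plane := (measurableTypeR R * measurableTypeR R)%type.

(** Open intervals and half-lines generate the measurable subsets of a line; the
    open rectangle, unlike the closed one, is itself cut out by such sets. *)
Definition cylinder_interior : set plane := `]0, 2 * pi[ `*` `]0, h[.
Let Di := cylinder_interior.

Let pi2 : 0 < 2 * pi :> R. Proof. by rewrite mulr_gt0// pi_gt0. Qed.

Lemma cylinder_interior_measurable : measurable Di.
Proof. by apply: measurableX; exact: measurable_itv. Qed.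

Lemma cylinder_interiorW : Di `<=` (cylinder h : set plane).
Proof. by move=> p [/= x0 y0]; split; exact: subset_itv_oo_cc. Qed.

(** The open and the closed rectangle have the same finite area. *)
Lemma cylinder_boundary0 : area R (cylinder h `\` Di) = 0%E.
Proof.
have mD := @cylinder_measurable R h.
have iE : area R Di = (2 * pi * h)%:E.
  rewrite product_measure1E//; [|exact: measurable_itv..].
  have lI (r : R) : 0 < r -> @lebesgue_measure R `]0, r[%classic = r%:E.
    by move=> r0; rewrite lebesgue_measure_itv/= lte_fin r0 -EFinB subr0.
  by apply: (etrans (congr2 mule (lI _ pi2) (lI _ h_gt0))).
have := @measureD _ _ _ (area R) _ _ mD cylinder_interior_measurable.
rewrite setIidr; last exact: cylinder_interiorW.
have aE := cylinder_area h_gt0.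
rewrite -/(area R) => ->; last by have := ltry (2 * pi * h); rewrite -aE.
by apply: (etrans (congr2 (fun a b => a - b)%E aE iE)); rewrite subee.
Qed.

Lemma cylinder_interior_ae : {ae area R, forall p, cylinder h p -> Di p}.
Proof.
exists (cylinder h `\` Di); split; last by move=> p /= /not_implyP.
  exact: measurableD (@cylinder_measurable R h) cylinder_interior_measurable.
exact: cylinder_boundary0.
Qed.

Lemma cint_interior f : cintegrable h f -> \int[area R]_(p in Di) f p = cint h f.
Proof.
move=> fi; have mD := @cylinder_measurable R h; have mDi := cylinder_interior_measurable.
rewrite /cint /Rintegral (negligible_integral _ _ fi cylinder_boundary0)//; last exact: measurableD.
by rewrite setDD setIidr//; exact: cylinder_interiorW.
Qed.

Lemma cintegrableM_continuous f g : cintegrable h f -> continuous g ->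
  cintegrable h (fun p => f p * g p).
Proof.
move=> fi cg; have [M gM] := continuous_bounded_cylinder h cg.
apply: (integrableM_bounded (@cylinder_measurable R h) fi _ gM).
by apply: measurable_funTS; exact: continuous_measurable_plane.
Qed.

Lemma cintegrable_interior f : cintegrable h f ->
  (area R).-integrable Di (EFin \o f).
Proof.
move=> fi; apply: integrableS fi; [exact: cylinder_measurable|
  exact: cylinder_interior_measurable|exact: cylinder_interiorW].
Qed.

(** The cosine decreases with the distance to x0 as long as this is at most pi;
    beyond pi the distance z is replaced with 2 pi - z, which exceeds r because
    the arc does not leave the interval. *)
Lemma cos_arc x0 r x : r <= x0 -> x0 + r <= 2 * pi -> 0 < r -> 0 < x < 2 * pi ->
  (cos r < cos (x - x0)) = (x0 - r < x < x0 + r).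
Proof.
move=> rx0 x0r r0 /andP[x_gt x_lt]; rewrite -ltr_distl -[cos (x - x0)]cos_norm.
have rpi : r <= pi by lra.
have zlt : `|x - x0| < 2 * pi - r by rewrite ltr_norml; apply/andP; split; lra.
have zge := normr_ge0 (x - x0); move: zlt zge; set z := `|x - x0| => zlt zge.
have rI : r \in `[0, pi] by rewrite in_itv/= ltW.
have [zpi|zpi] := leP z pi.
  have zI : z \in `[0, pi] by rewrite in_itv/= zge zpi.
  exact: ltr_cos.
have -> : cos z = cos (2 * pi - z).
  by rewrite -[in RHS]cosN opprB -[RHS](@cosD2pi R) mulr_natl subrK.
have zI : 2 * pi - z \in `[0, pi] by rewrite in_itv/=; apply/andP; split; lra.
rewrite ltr_cos//; apply/idP/idP; lra.
Qed.

(** The angle that runs through [0, pi] as y runs through [0, h], an interval on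
    which the cosine is injective. *)
Definition theta y := freq h 1 * y.

Lemma theta_itv y : 0 <= y <= h -> theta y \in `[0, pi].
Proof.
move=> /andP[y0 yh]; rewrite /theta /freq mul1r in_itv/=.
by rewrite mulr_ge0 ?divr_ge0 ?pi_ge0 ?(ltW h_gt0)//= -mulrA ler_piMr ?pi_ge0// ler_pdivrMl// mulr1.
Qed.

Lemma cos_theta y c : 0 <= y <= h -> 0 <= c <= h ->
  (cos (theta y) < cos (theta c)) = (c < y).
Proof.
move=> yI cI; rewrite ltr_cos ?theta_itv// /theta ltr_pM2l// /freq mul1r divr_gt0//.
exact: pi_gt0.
Qed.

Section Moments.
Variable f : R * R -> R.
Hypothesis fi : cintegrable h f.
Hypothesis moments : forall x0 i j,
  cint h (fun p => f p * (cos (p.1 - x0) ^+ i * cos (theta p.2) ^+ j)) = 0.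

Lemma continuous_cos_fst x0 : continuous (fun p : R * R => cos (p.1 - x0)).
Proof.
move=> p; apply: continuous_comp; last exact: continuous_cos.
apply: continuousD; [exact: cvg_fst|exact: cvg_cst].
Qed.

Lemma continuous_cos_theta : continuous (fun p : R * R => cos (theta p.2)).
Proof.
move=> p; apply: continuous_comp; last exact: continuous_cos.
apply: continuousM; [exact: cvg_cst|exact: cvg_snd].
Qed.

Lemma continuous_exp g n : continuous g -> continuous (fun p => g p ^+ n).
Proof.
move=> cg; elim: n => [|n IH] p; first exact: cvg_cst.
rewrite (_ : (fun p => g p ^+ n.+1) = (fun p => g p * g p ^+ n)).
  exact: continuousM (cg p) (IH p).
by apply/funext => q; rewrite exprS.
Qed.

(** Each side of the rectangle is given by a threshold for a cosine: first for
    cos (x - x0), with x0 the centre of the horizontal side, for every moment in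
    the other variable, and then for cos (theta y). *)
Lemma integral_rectangle a b c : 0 <= a -> a < b -> b <= 2 * pi -> 0 <= c < h ->
  \int[area R]_(p in Di `&` fst @^-1` `]a, b[ `&` snd @^-1` `]c, +oo[) f p = 0.
Proof.
move=> a0 ab b2 /andP[c0 ch].
pose x0 := (a + b) / 2; pose r := (b - a) / 2.
pose g1 (p : plane) := - cos (p.1 - x0); pose g2 (p : plane) := cos (theta p.2).
have mc g : continuous g -> forall A, measurable_fun A (g : plane -> R).
  by move=> cg A; apply: measurable_funTS; exact: continuous_measurable_plane.
have cg1 : continuous (g1 : R * R -> R).
  by move=> p; apply: continuousN; exact: continuous_cos_fst.
have cg2 : continuous (g2 : R * R -> R) by exact: continuous_cos_theta.
have mDi := cylinder_interior_measurable.
have D1 : Di `&` [set p | g1 p < - cos r] = Di `&` fst @^-1` `]a, b[.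
  apply/seteqP; split=> -[x y] [/= Dxy]; move: (Dxy) => -[/=];
   rewrite !in_itv/= => xI _ H; split=> //;
   move: H; rewrite /g1/= ?in_itv/= ltrN2 cos_arc//; rewrite /x0 /r; try lra;
   by move=> /andP[? ?]; apply/andP; split; lra.
have D2 : Di `&` fst @^-1` `]a, b[ `&` [set p | g2 p < cos (theta c)] =
    Di `&` fst @^-1` `]a, b[ `&` snd @^-1` `]c, +oo[.
  apply/seteqP; split=> -[x y] [/= [Dxy xab]]; move: (Dxy) => -[/=];
   rewrite !in_itv/= andbT => _ /andP[y0 yh] H; split=> //;
   move: H; rewrite /g2/= ?in_itv/= ?andbT cos_theta//; by apply/andP; split; lra.
have mD1 : measurable (Di `&` [set p | g1 p < - cos r]).
  rewrite D1; apply: measurableI => //; rewrite -[X in measurable X]setTI.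
  by apply: measurable_fst => //; exact: measurable_itv.
have fgi j : cintegrable h (fun p => f p * g2 p ^+ j).
  by apply: cintegrableM_continuous => //; exact: continuous_exp.
have iD1 g : cintegrable h g ->
    (area R).-integrable (Di `&` [set p | g1 p < - cos r]) (EFin \o g).
  by move=> gi; apply: integrableS (cintegrable_interior gi) => //; exact: subIsetl.
rewrite -D2 -D1; apply: (integral_threshold mD1 (iD1 _ fi) (mc _ cg2 _)).
- by move=> p _; exact: cos_max.
- exact: cos_max.
move=> j; apply: (integral_threshold mDi (cintegrable_interior (fgi j)) (mc _ cg1 _)).
- by move=> p _; rewrite normrN cos_max.
- by rewrite normrN cos_max.
move=> i; rewrite cint_interior; last first.
  by apply: cintegrableM_continuous => //; exact: continuous_exp.
rewrite -[RHS](mulr0 ((-1) ^+ i)) -(moments x0 i j) -cintZ; last first.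
  apply: cintegrableM_continuous => // p.
  exact: continuousM (@continuous_exp _ i (@continuous_cos_fst x0) p)
    (@continuous_exp _ j continuous_cos_theta p).
by apply: eq_cint => p _; rewrite /g1 /g2/= [(- cos _) ^+ _]exprNn; ring.
Qed.

Lemma moments_interior0 : \int[area R]_(p in Di) f p = 0.
Proof.
rewrite cint_interior//; rewrite -[RHS](moments 0 0 0); apply: eq_cint => p _.
by rewrite !expr0 !mulr1.
Qed.

(** The part of the rectangle inside the cylinder is again a rectangle. *)
Lemma integral_open_rectangle a b c :
  \int[area R]_(p in Di `&` fst @^-1` `]a, b[ `&` snd @^-1` `]c, +oo[) f p = 0.
Proof.
pose a' := Num.max a 0; pose b' := Num.min b (2 * pi); pose c' := Num.max c 0.
have E : Di `&` fst @^-1` `]a, b[ `&` snd @^-1` `]c, +oo[ =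
    Di `&` fst @^-1` `]a', b'[ `&` snd @^-1` `]c', +oo[.
  apply/seteqP; split=> -[x y] [/= [Dxy]]; move: (Dxy) => -[/=];
    rewrite !in_itv/= !andbT /a' /b' /c' !gt_max !lt_min => /andP[x0 x2] /andP[y0 yh].
    by move=> /andP[-> ->] ->; rewrite x0 x2 y0.
  by move=> /andP[/andP[-> _] /andP[-> _]] /andP[-> _].
rewrite E; have [ab|ba] := ltP a' b'; last first.
  rewrite (_ : _ `&` _ = set0) ?Rintegral_set0// -subset0 => -[x y] [[_ /=]].
  by rewrite in_itv/= => /andP[ax xb] _; have := lt_trans ax xb; rewrite ltNge ba.
have [ch|hc] := ltP c' h; last first.
  rewrite (_ : _ `&` _ = set0) ?Rintegral_set0// -subset0 => -[x y] [[[_ /=]]].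
  by rewrite !in_itv/= andbT => /andP[_ yh] _ cy; have := lt_trans cy yh; rewrite ltNge hc.
apply: integral_rectangle => //.
- by rewrite le_max lexx orbT.
- by rewrite ge_min lexx orbT.
- by rewrite le_max lexx orbT.
Qed.

(** Dynkin's lemma in the first coordinate, starting from open intervals, and
    then in the second, starting from half-lines. *)
Lemma integral_measurable_rectangle (A B : set (measurableTypeR R)) :
  measurable A -> measurable B ->
  \int[area R]_(p in Di `&` fst @^-1` A `&` snd @^-1` B) f p = 0.
Proof.
move=> mA mB; have mDi := cylinder_interior_measurable.
have mfst (C : set (measurableTypeR R)) : measurable C -> measurable (fst @^-1` C : set plane).
  by move=> mC; rewrite -setXT; exact: measurableX.
have msnd (C : set (measurableTypeR R)) : measurable C -> measurable (snd @^-1` C : set plane).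
  by move=> mC; rewrite -setTX; exact: measurableX.
have sub (E : set plane) : measurable E -> (area R).-integrable (Di `&` E) (EFin \o f).
  move=> mE; apply: integrableS (cintegrable_interior fi) => //; exact: measurableI.
have DT : Di `&` snd @^-1` `]0, +oo[ = Di.
  apply/seteqP; split=> [p []//|-[x y] Dxy]; split=> //=.
  by case: Dxy => _ /=; rewrite !in_itv/= andbT => /andP[].
have D0 : Di `&` fst @^-1` `]0, 2 * pi[ = Di.
  apply/seteqP; split=> [p []//|-[x y] Dxy]; split=> //=.
  by case: Dxy.
have stage1 c : forall A, measurable A ->
    \int[area R]_(p in Di `&` snd @^-1` `]c, +oo[ `&` fst @^-1` A) f p = 0.
  apply: (integral0_dynkin (RGenOpens.measurableE R)) => //.
  - move=> _ _ [a1 [b1 ->]] [a2 [b2 ->]]; exists (Num.max a1 a2), (Num.min b1 b2).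
    apply/seteqP; split=> x /=; rewrite !in_itv/= gt_max lt_min.
      by move=> [/andP[-> ->] /andP[-> ->]].
    by move=> /andP[/andP[-> ->] /andP[-> ->]].
  - by apply: measurableI => //; apply: msnd; exact: measurable_itv.
  - by apply: sub; apply: msnd; exact: measurable_itv.
  - by rewrite -{1}D0 integral_open_rectangle.
  - by move=> _ [a [b ->]]; rewrite setIAC; exact: integral_open_rectangle.
apply: (integral0_dynkin (RGenOInfty.measurableE R)) mB => //.
- move=> _ _ [a1 ->] [a2 ->]; exists (Num.max a1 a2).
  by apply/seteqP; split=> x /=; rewrite !in_itv/= !andbT gt_max => /andP.
- by apply: measurableI => //; exact: mfst.
- by apply: sub; exact: mfst.
- by have := stage1 0 A mA; rewrite DT.
- by move=> _ [c ->]; rewrite setIAC; exact: stage1.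
Qed.

(** Dynkin's lemma extends the vanishing of the integral from measurable
    rectangles to all measurable subsets. *)
Lemma vanishing_moments_ae0 : {ae area R, forall p, cylinder h p -> f p = 0}.
Proof.
have mDi := cylinder_interior_measurable.
have all0 : forall A : set plane, measurable A -> \int[area R]_(p in Di `&` A) f p = 0.
  apply: (@integral0_dynkin _ _ _ (area R) _ plane _
    (@measurable_prod_measurableType _ _ _ _) _ _ mDi f idfun (cintegrable_interior fi)) => //.
  - move=> _ _ [A1 mA1 [A2 mA2 <-]] [B1 mB1 [B2 mB2 <-]].
    exists (A1 `&` B1); first exact: measurableI.
    by exists (A2 `&` B2); [exact: measurableI|rewrite setXI].
  - exact: measurable_id.
  - exact: moments_interior0.
  - by move=> _ [A mA [B mB <-]]; have := integral_measurable_rectangle mA mB; rewrite -setIA.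
have ae : ae_eq (area R) Di (EFin \o f) (cst 0%E).
  apply: integral_ae_eq => //; first exact: cintegrable_interior.
  move=> E ED mE; rewrite integral0.
  have := all0 E mE; rewrite setIidr// /Rintegral => R0.
  apply/eqP; rewrite -fine_eq0; first by apply/eqP.
  apply: integrable_fin_num => //; apply: integrableS (cintegrable_interior fi) => //.
move: ae cylinder_interior_ae; apply: filterS2 => p D0 Dip Dp.
by have [] := D0 (Dip Dp).
Qed.

End Moments.

Section ClosedFamily.
Variables (f : R * R -> R) (I : Type) (e : I -> R * R -> R) (C : R * R -> R).
Hypothesis fi : cintegrable h f.
Hypothesis ce : forall i, continuous (e i).
Hypothesis cC : continuous C.
Hypothesis closed : forall i, exists i1 i2 (a b : R),
  forall p, e i p * C p = a * e i1 p + b * e i2 p.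
Hypothesis fe : forall i, cint h (fun p => f p * e i p) = 0.

(** If multiplication by C maps each member of a family to a combination of
    members, then orthogonality to the family is inherited by the products with
    the powers of C. *)
Lemma vanishing_moments_closed j : forall i, cint h (fun p => f p * (e i p * C p ^+ j)) = 0.
Proof.
have ceC i k : continuous (fun p => e i p * C p ^+ k).
  by move=> p; exact: continuousM (@ce i p) (@continuous_exp _ k cC p).
elim: j => [|j IH] i.
  by rewrite -(fe i); apply: eq_cint => p _; rewrite expr0 mulr1.
have [i1 [i2 [a [b E]]]] := closed i.
have int k : cintegrable h (fun p => f p * (e k p * C p ^+ j)).
  exact: cintegrableM_continuous.
transitivity (cint h (fun p => a * (f p * (e i1 p * C p ^+ j)) +
    b * (f p * (e i2 p * C p ^+ j)))).
  apply: eq_cint => p _; rewrite exprS; move: (E p) (C p ^+ j) => Ep z.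
  transitivity (f p * (e i p * C p * z)); first by ring.
  by rewrite Ep; ring.
rewrite cintD; [|exact: cintegrableZ (int _)..].
by rewrite !cintZ// !IH !mulr0 addr0.
Qed.

End ClosedFamily.

Lemma cosM_half x y : cos x * cos y = 2^-1 * cos (x + y) + 2^-1 * cos (x - y).
Proof. by rewrite cosD cosB; field. Qed.

Lemma sinM_half x y : sin x * cos y = 2^-1 * sin (x + y) + 2^-1 * sin (x - y).
Proof. by rewrite sinD sinB; field. Qed.

Lemma natr_freq k y : freq h k * y = k%:R * theta y.
Proof. by rewrite /theta /freq; ring. Qed.

Lemma continuous_cos_affine_fst (a b : R) : continuous (fun p : R * R => cos (a * p.1 + b)).
Proof.
move=> p; apply: continuous_comp; last exact: continuous_cos.
by apply: continuousD; [apply: continuousM; [exact: cvg_cst|exact: cvg_fst]|exact: cvg_cst].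
Qed.

Lemma continuous_cos_affine_snd (a : R) : continuous (fun p : R * R => cos (a * p.2)).
Proof.
move=> p; apply: continuous_comp; last exact: continuous_cos.
by apply: continuousM; [exact: cvg_cst|exact: cvg_snd].
Qed.

(** Products of cosines are sums of cosines, so the trigonometric families are
    closed under multiplication by cos (x - x0) and by cos (theta y).  The
    vertical factor Y stands for the cosines or the sines. *)
Lemma fourier_moments f (Y : nat -> R -> R) : cintegrable h f ->
  (forall k, continuous (fun p : R * R => Y k p.2)) ->
  (forall k, exists k1 k2 (a b : R), forall y,
     Y k y * cos (theta y) = a * Y k1 y + b * Y k2 y) ->
  (forall n phi k, cint h (fun p => f p * (cos (n%:R * p.1 + phi) * Y k p.2)) = 0) ->
  forall k x0 i j,
  cint h (fun p => f p * Y k p.2 * (cos (p.1 - x0) ^+ i * cos (theta p.2) ^+ j)) = 0.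
Proof.
move=> fi cY closedY fe k x0 i j.
pose e (m : nat * R * nat) (p : R * R) := cos (m.1.1%:R * p.1 + m.1.2) * Y m.2 p.2.
have ce m : continuous (e m).
  move=> p; exact: continuousM (@continuous_cos_affine_fst _ _ p) (cY _ p).
have step1 : forall m, cint h (fun p => f p * (e m p * cos (p.1 - x0) ^+ i)) = 0.
  apply: vanishing_moments_closed => //; last by move=> m; exact: fe.
    exact: continuous_cos_fst.
  move=> [[n phi] l]; exists (n.+1, phi - x0, l).
  (* for n = 0 the lower wave number would be -1; the parity of the cosine brings it back to 1 *)
  case: n => [|n].
    exists (1%N, - phi - x0, l), 2^-1, 2^-1 => p; rewrite /e/= mul0r add0r mul1r mulrAC.
    rewrite cosM_half -[cos (phi - _)]cosN mulrDl !mulrA.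
    by congr (_ * cos _ * _ + _ * cos _ * _); ring.
  exists (n, phi + x0, l), 2^-1, 2^-1 => p; rewrite /e/= mulrAC.
  rewrite cosM_half mulrDl !mulrA.
  by congr (_ * cos _ * _ + _ * cos _ * _); rewrite -natr1; ring.
have step2 : forall m, cint h (fun p =>
    f p * (e m p * cos (p.1 - x0) ^+ i * cos (theta p.2) ^+ j)) = 0.
  apply: (@vanishing_moments_closed f _ (fun m p => e m p * cos (p.1 - x0) ^+ i)
    (fun p => cos (theta p.2))) => //.
  - move=> m p; exact: continuousM (ce m p) (@continuous_exp _ i (@continuous_cos_fst x0) p).
  - exact: continuous_cos_theta.
  - move=> [[n phi] l]; have [k1 [k2 [a [b E]]]] := closedY l.
    exists (n, phi, k1), (n, phi, k2), a, b => p; rewrite /e/=.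
    transitivity (cos (n%:R * p.1 + phi) * cos (p.1 - x0) ^+ i *
      (Y l p.2 * cos (theta p.2))); first by ring.
    by rewrite E; ring.
rewrite -(step2 (0%N, 0, k)); apply: eq_cint => p _.
by rewrite /e/= mul0r add0r cos0 mul1r; ring.
Qed.

Lemma fourier_cos_complete f : cintegrable h f ->
  (forall n phi k, cint h (fun p => f p * (cos (n%:R * p.1 + phi) * cos (freq h k * p.2))) = 0) ->
  {ae area R, forall p, cylinder h p -> f p = 0}.
Proof.
move=> fi fe; apply: vanishing_moments_ae0 => // x0 i j.
rewrite -[RHS](@fourier_moments f (fun k y => cos (freq h k * y)) fi _ _ fe 0%N x0 i j).
- by apply: eq_cint => p _; rewrite /freq mul0r !mul0r cos0 mulr1.
- by move=> k p; exact: (@continuous_cos_affine_snd (freq h k)).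
- move=> [|k]; [exists 1%N, 1%N|exists k.+2, k]; exists 2^-1, 2^-1 => y.
    by rewrite /theta /freq !mul0r cos0 mul1r -mulrDr mulrC -[LHS]mulr1; field.
  rewrite !natr_freq cosM_half -natr1 -[k.+2%:R]natr1 -natr1.
  by congr (_ * cos _ + _ * cos _); ring.
Qed.

(** The vertical factors form a family closed under multiplication by
    cos (theta y) that contains sin (theta y) instead of 1, so the moments of
    f sin (theta y) vanish; and sin (theta y) > 0 inside the cylinder. *)
Lemma fourier_sin_complete f : cintegrable h f ->
  (forall n phi k, cint h (fun p => f p * (cos (n%:R * p.1 + phi) * sin (freq h k * p.2))) = 0) ->
  {ae area R, forall p, cylinder h p -> f p = 0}.
Proof.
move=> fi fe.
have csin (a : R) : continuous (fun p : R * R => sin (a * p.2)).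
  move=> p; apply: continuous_comp; last exact: continuous_sin.
  by apply: continuousM; [exact: cvg_cst|exact: cvg_snd].
have fs : {ae area R, forall p, cylinder h p -> f p * sin (freq h 1 * p.2) = 0}.
  apply: vanishing_moments_ae0 => [|x0 i j]; first exact: cintegrableM_continuous.
  apply: (@fourier_moments f (fun k y => sin (freq h k * y)) fi _ _ fe 1%N x0 i j).
  - by move=> k; exact: csin.
  - move=> [|k]; [exists 0%N, 0%N|exists k.+2, k]; exists 2^-1, 2^-1 => y.
      by rewrite /freq !mul0r sin0; ring.
    rewrite !natr_freq sinM_half -natr1 -[k.+2%:R]natr1 -natr1.
    by congr (_ * sin _ + _ * sin _); ring.
have FF : Filter (almost_everywhere (area R)) by exact: ae_filter_ringOfSetsType.
move: fs cylinder_interior_ae; apply: filterS2 => p fs Dip Dp.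
have /eqP := fs Dp; rewrite mulf_eq0 => /orP[/eqP//|/eqP s0]; exfalso.
case: (Dip Dp) => _ /=; rewrite in_itv/= => /andP[y0 yh].
suff : 0 < sin (freq h 1 * p.2) by rewrite s0 ltxx.
apply: sin_gt0_pi; rewrite /freq mul1r mulr_gt0 ?divr_gt0 ?pi_gt0//=.
by rewrite -mulrA gtr_pMr ?pi_gt0// ltr_pdivrMl// mulr1.
Qed.

End Uniqueness.

(** * Scalar products of cosine products *)

Section ModeProducts.
Context {R : realType}.
Variable h : R.
Hypothesis h_gt0 : 0 < h.
Implicit Types (n k : nat) (phi psi : R).

(** A wave of amplitude 1.  The scalar products of modes are combinations of the
    scalar products of these functions. *)
Definition cosprod n k phi psi : R * R -> R := wave 1 n%:R phi (freq h k) psi.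

Definition pairing n k phi psi n' k' phi' psi' : R :=
  cint h (fun p => cosprod n k phi psi p * cosprod n' k' phi' psi' p).

Lemma cosprod_C1 n k phi psi : C1 (cosprod n k phi psi).
Proof. by apply: smooth_C1; exact: smooth_wave. Qed.

Lemma cosprod_smooth n k phi psi : smooth_on_cylinder (cosprod n k phi psi).
Proof. exact: wave_smooth_on_cylinder. Qed.

Lemma cosprod_continuous n k phi psi : continuous (cosprod n k phi psi).
Proof. exact: continuous_wave. Qed.

Lemma pairing_integrable n k phi psi n' k' phi' psi' :
  cintegrable h (fun p => cosprod n k phi psi p * cosprod n' k' phi' psi' p).
Proof.
apply: continuous_integrable_cylinder => // p.
exact: continuousM (@cosprod_continuous n k phi psi p) (@cosprod_continuous n' k' phi' psi' p).
Qed.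

Lemma waveZ (c a al b be : R) : wave c a al b be = fun p => c * wave 1 a al b be p.
Proof. by apply/funext => p; rewrite /wave mul1r. Qed.

Lemma partial1_cosprod n k phi psi p :
  partial 0 (cosprod n k phi psi) p = n%:R * cosprod n k (phi + pi / 2) psi p.
Proof. by rewrite /cosprod partial1_wave mul1r waveZ. Qed.

Lemma partial2_cosprod n k phi psi p :
  partial 1 (cosprod n k phi psi) p = freq h k * cosprod n k phi (psi + pi / 2) p.
Proof. by rewrite /cosprod partial2_wave mul1r waveZ. Qed.

(** The phases of cos (kappa y) and sin (kappa y).  For each of them, a wave with
    this vertical phase times one with the phase shifted by pi / 2 vanishes at
    y = 0 and y = h, whatever the vertical wave numbers. *)
Definition boundary_phase psi := psi = 0 \/ psi = - (pi / 2).

Lemma pairing_parts1 n k phi psi n' k' phi' psi' :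
  n'%:R * pairing n k phi psi n' k' (phi' + pi / 2) psi' =
  - (n%:R * pairing n k (phi + pi / 2) psi n' k' phi' psi').
Proof.
have P := cint_parts1 h_gt0 (cosprod_C1 n' k' phi' psi') (cosprod_C1 n k phi psi)
  (fun y => smooth_periodic y (cosprod_smooth _ _ _ _))
  (fun y => smooth_periodic y (cosprod_smooth _ _ _ _)).
rewrite /pairing -cintZ; last exact: pairing_integrable.
rewrite -cintZ; last exact: pairing_integrable.
move: P; congr (_ = - _); apply: eq_cint => p _; rewrite partial1_cosprod; ring.
Qed.

Lemma pairing_parts2 n k phi psi n' k' phi' psi' :
  (forall x, cosprod n' k' phi' psi' (x, h) * cosprod n k phi psi (x, h) =
             cosprod n' k' phi' psi' (x, 0) * cosprod n k phi psi (x, 0)) ->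
  freq h k' * pairing n k phi psi n' k' phi' (psi' + pi / 2) =
  - (freq h k * pairing n k phi (psi + pi / 2) n' k' phi' psi').
Proof.
move=> bnd.
have P := cint_parts2 h_gt0 (cosprod_C1 n' k' phi' psi') (cosprod_C1 n k phi psi) bnd.
rewrite /pairing -cintZ; last exact: pairing_integrable.
rewrite -cintZ; last exact: pairing_integrable.
move: P; congr (_ = - _); apply: eq_cint => p _; rewrite partial2_cosprod; ring.
Qed.

Lemma cosprodDpi1 n k phi psi p :
  cosprod n k (phi + pi / 2 + pi / 2) psi p = - cosprod n k phi psi p.
Proof.
by rewrite /cosprod /wave !addrA cosDpihalf sinDpihalf; ring.
Qed.

Lemma cosprodDpi2 n k phi psi p :
  cosprod n k phi (psi + pi / 2 + pi / 2) p = - cosprod n k phi psi p.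
Proof.
by rewrite /cosprod /wave !addrA cosDpihalf sinDpihalf; ring.
Qed.

Lemma pairingC n k phi psi n' k' phi' psi' :
  pairing n k phi psi n' k' phi' psi' = pairing n' k' phi' psi' n k phi psi.
Proof. by apply: eq_cint => p _; rewrite mulrC. Qed.

Lemma pairingDpi1 n k phi psi n' k' phi' psi' :
  pairing n k phi psi n' k' (phi' + pi / 2 + pi / 2) psi' =
  - pairing n k phi psi n' k' phi' psi'.
Proof.
rewrite -mulN1r -cintZ; last exact: pairing_integrable.
by apply: eq_cint => p _; rewrite cosprodDpi1; ring.
Qed.

Lemma pairingDpi2 n k phi psi n' k' phi' psi' :
  pairing n k phi psi n' k' phi' (psi' + pi / 2 + pi / 2) =
  - pairing n k phi psi n' k' phi' psi'.
Proof.
rewrite -mulN1r -cintZ; last exact: pairing_integrable.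
by apply: eq_cint => p _; rewrite cosprodDpi2; ring.
Qed.

(** Integration by parts moves a derivative from one factor to the other, and a
    second quarter-period shift of the phase is a change of sign. *)
Lemma pairing_shift1 n k phi psi n' k' phi' psi' :
  n'%:R * pairing n k phi psi n' k' phi' psi' =
  n%:R * pairing n k (phi + pi / 2) psi n' k' (phi' + pi / 2) psi'.
Proof.
have := pairing_parts1 n k phi psi n' k' (phi' + pi / 2) psi'.
by rewrite pairingDpi1 mulrN => /oppr_inj.
Qed.

Lemma cosprod_bnd0 n k phi psi x : boundary_phase psi ->
  (forall n' k' phi', cosprod n k phi psi (x, h) * cosprod n' k' phi' (psi + pi / 2) (x, h) =
     cosprod n k phi psi (x, 0) * cosprod n' k' phi' (psi + pi / 2) (x, 0)).
Proof.
move=> [] -> n' k' phi'; rewrite /cosprod /wave/=; last first.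
  by rewrite !cosBpihalf sin_freq// !mulr0 sin0 !mulr0 !mul0r.
by rewrite !add0r !cosDpihalf sin_freq// !mulr0 sin0 oppr0 !mulr0.
Qed.

Lemma pairing_shift2 n k phi psi n' k' phi' : boundary_phase psi ->
  freq h k' * pairing n k phi psi n' k' phi' psi =
  freq h k * pairing n k phi (psi + pi / 2) n' k' phi' (psi + pi / 2).
Proof.
move=> bp; have := pairing_parts2 (n := n) (k := k) (phi := phi) (psi := psi) (n' := n')
  (k' := k') (phi' := phi') (psi' := psi + pi / 2).
rewrite pairingDpi2 mulrN => E; apply/oppr_inj/E => x.
by rewrite mulrC cosprod_bnd0// mulrC.
Qed.

(** Two applications of pairing_shift1 show that n^2 and n'^2 multiply the
    scalar product to the same number. *)
Lemma pairing_orth1 n k phi psi n' k' phi' psi' : n != n' ->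
  pairing n k phi psi n' k' phi' psi' = 0.
Proof.
move=> nn'; have E1 := pairing_shift1 n k phi psi n' k' phi' psi'.
have E2 := pairing_shift1 n' k' phi' psi' n k phi psi.
rewrite [in RHS]pairingC [in LHS]pairingC in E2.
move: (pairing n k (phi + _) _ _ _ _ _) E1 E2 => d; set c := pairing _ _ _ _ _ _ _ _ => E1 E2.
have E : (n%:R ^+ 2 - n'%:R ^+ 2) * c = 0.
  transitivity (n%:R * (n%:R * c) - n'%:R * (n'%:R * c)); first by ring.
  by rewrite E1 E2; ring.
move/eqP: E; rewrite mulf_eq0 => /orP[|/eqP//].
by rewrite subr_eq0 eqrXn2// eqr_nat (negbTE nn').
Qed.

Lemma freq_ge0 k : 0 <= freq h k.
Proof. by rewrite /freq divr_ge0 ?(ltW h_gt0)// mulr_ge0 ?pi_ge0. Qed.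

Lemma freq_gt0 k : (0 < k)%N -> 0 < freq h k.
Proof. by move=> k0; rewrite /freq divr_gt0// mulr_gt0 ?pi_gt0// ltr0n. Qed.

Lemma freq_inj k k' : freq h k = freq h k' -> k = k'.
Proof.
rewrite /freq => /(mulIf _)/wrap[]; first by rewrite invr_neq0// gt_eqF.
move=> /(mulIf _)/wrap[]; first by rewrite gt_eqF// pi_gt0.
by move=> /eqP; rewrite eqr_nat => /eqP.
Qed.

Lemma pairing_orth2 n k phi psi n' k' phi' : boundary_phase psi -> k != k' ->
  pairing n k phi psi n' k' phi' psi = 0.
Proof.
move=> bp kk'; have E1 := pairing_shift2 n k phi n' k' phi' bp.
have E2 := pairing_shift2 n' k' phi' n k phi bp.
rewrite [in RHS]pairingC [in LHS]pairingC in E2.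
move: (pairing n k _ (psi + _) _ _ _ _) E1 E2 => d; set c := pairing _ _ _ _ _ _ _ _ => E1 E2.
have E : (freq h k ^+ 2 - freq h k' ^+ 2) * c = 0.
  transitivity (freq h k * (freq h k * c) - freq h k' * (freq h k' * c)); first by ring.
  by rewrite E1 E2; ring.
move/eqP: E; rewrite mulf_eq0 => /orP[|/eqP//].
rewrite subr_eq0 eqrXn2// ?freq_ge0// => /eqP/freq_inj/eqP.
by rewrite (negbTE kk').
Qed.

(** A periodic function is orthogonal to its derivative. *)
Lemma pairing_orth_phase n k phi psi : (0 < n)%N ->
  pairing n k phi psi n k (phi + pi / 2) psi = 0.
Proof.
move=> n0; have := pairing_parts1 n k phi psi n k phi psi.
rewrite [in RHS]pairingC -mulrN => /mulfI/wrap[]; first by rewrite pnatr_eq0 -lt0n.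
by move/eqP; rewrite -addr_eq0 -mulr2n mulrn_eq0 => /eqP.
Qed.

Definition sqnorm n k phi psi := pairing n k phi psi n k phi psi.

Lemma sqnorm_ge0 n k phi psi : 0 <= sqnorm n k phi psi.
Proof. by apply: cint_ge0 => p; rewrite -expr2 sqr_ge0. Qed.

(** The sum of the squares of a cosine and a sine is 1. *)
Lemma sqnorm_split1 n k phi psi :
  sqnorm n k phi psi + sqnorm n k (phi + pi / 2) psi = sqnorm 0 k 0 psi.
Proof.
rewrite -cintD; [|exact: pairing_integrable..]; apply: eq_cint => p _.
rewrite /cosprod /wave/= addrA cosDpihalf mul0r addr0 cos0.
have := cos2Dsin2 (n%:R * p.1 + phi).
move: (cos (n%:R * _ + _)) (sin (n%:R * _ + _)) (cos (freq _ _ * _ + _)) => u v w E.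
by transitivity ((u ^+ 2 + v ^+ 2) * w ^+ 2); [ring|rewrite E; ring].
Qed.

Lemma sqnorm_split2 n k phi psi :
  sqnorm n k phi psi + sqnorm n k phi (psi + pi / 2) = sqnorm n 0 phi 0.
Proof.
rewrite -cintD; [|exact: pairing_integrable..]; apply: eq_cint => p _.
rewrite /cosprod /wave/= /freq !mul0r addrA addr0 cosDpihalf cos0.
have := cos2Dsin2 (k%:R * pi / h * p.2 + psi).
move: (cos (_ + psi)) (sin (_ + psi)) (cos (_ + phi)) => u v w E.
by transitivity ((u ^+ 2 + v ^+ 2) * w ^+ 2); [ring|rewrite E; ring].
Qed.

Lemma sqnorm0 : sqnorm 0 0 0 0 = 2 * pi * h.
Proof.
rewrite /sqnorm /pairing (eq_cint (g := fun=> 1)); last first.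
  by move=> p _; rewrite /cosprod /wave/= /freq !mul0r !addr0 cos0 !mulr1.
rewrite /cint Rintegral_cst ?mul1r; last exact: cylinder_measurable.
by have /(congr1 fine) := cylinder_area h_gt0.
Qed.

(** For n > 0 the two halves of sqnorm_split1 are equal by pairing_shift1, so a
    phase can be dropped at the cost of a factor 2; likewise for k > 0. *)
Lemma sqnorm_gt0 n k phi psi : boundary_phase psi ->
  (0 < n)%N || (cos phi != 0) -> (0 < k)%N || (cos psi != 0) ->
  0 < sqnorm n k phi psi.
Proof.
move=> bp.
have y0 : (0 < k)%N || (cos psi != 0) -> 0 < sqnorm 0 k 0 psi.
  case: (posnP k) => [->/= c0|k0 _].
    have -> : sqnorm 0 0 0 psi = sqnorm 0 0 0 0.
      case: bp c0 => [->//|->]; rewrite cosN cos_pihalf eqxx//.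
    by rewrite sqnorm0 !mulr_gt0// pi_gt0.
  have := pairing_shift2 0 k 0 0 k 0 bp.
  move/mulfI => /(_ _)/wrap[]; first by rewrite gt_eqF// freq_gt0.
  move=> E; have := sqnorm_split2 0 k 0 psi; rewrite -[sqnorm _ _ _ (psi + _)]E sqnorm0 => E2.
  have : 0 < 2 * pi * h by rewrite !mulr_gt0// pi_gt0.
  by rewrite -E2 -mulr2n pmulrn_lgt0.
move=> x0 /y0; case: (posnP n) x0 => [->/= c0|n0 _] S0.
  have -> : sqnorm 0 k phi psi = cos phi ^+ 2 * sqnorm 0 k 0 psi.
    rewrite -cintZ; last exact: pairing_integrable.
    by apply: eq_cint => p _; rewrite /cosprod /wave/= !mul0r !add0r cos0; ring.
  by rewrite mulr_gt0// exprn_even_gt0.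
have := pairing_shift1 n k phi psi n k phi psi.
move/mulfI => /(_ _)/wrap[]; first by rewrite pnatr_eq0 -lt0n.
move=> E; have := sqnorm_split1 n k phi psi; rewrite -[sqnorm _ _ (phi + _) _]E => E2.
by move: S0; rewrite -E2 -mulr2n pmulrn_lgt0.
Qed.

End ModeProducts.

(** * Eigenfields *)

Section EigenFields.
Context {R : realType}.
Variables (lambda mu h : R).
Hypotheses (h_gt0 : 0 < h) (mu_gt0 : 0 < mu) (lambda_mu_gt0 : 0 < lambda + mu).
Implicit Types (n k : nat) (sg tau : bool) (Lam : R) (u w : vfield R).

(** In (n, k, (sg, tau)), n and k are the wave numbers, sg chooses one of two
    phases and tau tells shear from compression. *)
Definition mode_index := (nat * nat * (bool * bool))%type.
Implicit Types (i j : mode_index).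

Definition phase sg : R := if sg then pi / 2 else 0.
Definition amplitude1 n k tau : R := if tau then freq h k else n%:R.
(** The term [n = k = 0] replaces the zero eigenvector (kappa, n) = (0, 0) with
    (0, 1), so that the shear mode of index (0, 0) is the constant field. *)
Definition amplitude2 n k tau : R :=
  if tau then (n + ((n == 0) && (k == 0)))%N%:R else - freq h k.
Definition speed tau : R := if tau then mu else lambda + 2 * mu.

Definition eigenfield i : vfield R :=
  let: (n, k, (sg, tau)) := i in
  mode h n k (phase sg) (amplitude1 n k tau) (amplitude2 n k tau).

Definition eigenvalue_of i : R :=
  let: (n, k, (sg, tau)) := i in speed tau * (n%:R ^+ 2 + freq h k ^+ 2).

(** These are exactly the indices of the eigenfields that do not vanish.  For
    k = 0 and n > 0 the compressional amplitudes leave only a field proportional to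
    sin (kappa y) = 0.  For n = 0 only one of the two phases survives: that of
    the sine factor for shear with k > 0, that of the cosine factor
    otherwise. *)
Definition admissible i : bool :=
  let: (n, k, (sg, tau)) := i in
  (tau || (0 < k)%N) && ((0 < n)%N || (sg == (tau && (0 < k)%N))).

Lemma freq0 : freq h 0 = 0.
Proof. by rewrite /freq !mul0r. Qed.

Lemma eigen_amplitudes_eigenfield n k tau :
  eigen_amplitudes lambda mu h n k (amplitude1 n k tau) (amplitude2 n k tau)
    (speed tau * (n%:R ^+ 2 + freq h k ^+ 2)).
Proof.
rewrite /eigen_amplitudes /amplitude1 /amplitude2 /speed; case: tau; last by split; ring.
case: n => [|n]; case: k => [|k]; rewrite ?freq0 /= ?addn0; split; ring.
Qed.

Lemma eigenfield_DF_solution i : DF_solution lambda mu h (eigenvalue_of i) (eigenfield i).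
Proof.
by case: i => -[n k] [sg tau]; apply: mode_DF_solution => //; exact: eigen_amplitudes_eigenfield.
Qed.

Lemma solution_eigenfield_orthogonal Lam u i : DF_solution lambda mu h Lam u ->
  (Lam - eigenvalue_of i) * inner h u (eigenfield i) = 0.
Proof.
case: i => -[n k] [sg tau] su.
exact: (solution_mode_orthogonal h_gt0 _ (eigen_amplitudes_eigenfield n k tau)).
Qed.

Lemma inadmissible_eigenfield0 i : ~~ admissible i -> forall a p, eigenfield i a p = 0.
Proof.
case: i => -[n k] [sg tau]; rewrite /admissible negb_and !negb_or => H a p.
rewrite /eigenfield; case: (ord2P a) => ->; rewrite ?mode1E ?mode2E; move: H.
  case: (posnP k) => [->|k0]; first by rewrite freq0 mul0r sin0 !mulr0.
  rewrite /= andbF andbT /=; case: (posnP n) => [->|//]; rewrite mul0r add0r.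
  by case: tau sg => -[]; rewrite //= ?sin0 ?mul0r ?mulr0.
case: (posnP k) => [->|k0].
  rewrite /= andbT andbF; case: tau => /=; last by rewrite freq0 oppr0 mul0r.
  by case: (posnP n) => [->|//]; case: sg => //= _; rewrite mul0r add0r cos_pihalf mul0r mulr0.
rewrite /= andbF andbT /=; case: (posnP n) => [->|//]; rewrite mul0r add0r.
by case: tau sg => -[]//= _; rewrite ?cos_pihalf ?mul0r ?mulr0 // /amplitude2 (gtn_eqF k0)/= ?mul0r.
Qed.

Lemma inner_eigenfields n k sg tau n' k' sg' tau' :
  inner h (eigenfield (n, k, (sg, tau))) (eigenfield (n', k', (sg', tau'))) =
  amplitude1 n k tau * amplitude1 n' k' tau' *
    pairing h n k (phase sg - pi / 2) (- (pi / 2)) n' k' (phase sg' - pi / 2) (- (pi / 2)) +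
  amplitude2 n k tau * amplitude2 n' k' tau' *
    pairing h n k (phase sg) 0 n' k' (phase sg') 0.
Proof.
have pI := pairing_integrable h_gt0.
rewrite -cintZ; last exact: pI.
rewrite -[X in _ + X]cintZ; last exact: pI.
rewrite -cintD; [|exact: cintegrableZ (pI _ _ _ _ _ _ _ _)..].
apply: eq_cint => p _; rewrite sum2E /eigenfield /mode/=.
rewrite !(waveZ (amplitude1 _ _ _)) !(waveZ (amplitude2 _ _ _)) /cosprod; ring.
Qed.

Lemma pairing_phase_orth n k sg sg' (c psi : R) : (0 < n)%N -> sg != sg' ->
  pairing h n k (phase sg + c) psi n k (phase sg' + c) psi = 0.
Proof.
move=> n0; rewrite /phase; case: sg sg' => -[]//= _; rewrite add0r [pi / 2 + c]addrC.
  by rewrite pairingC pairing_orth_phase.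
by rewrite pairing_orth_phase.
Qed.

Lemma speed_inj tau tau' : speed tau = speed tau' -> tau = tau'.
Proof. by case: tau; case: tau' => //; rewrite /speed/= => E; exfalso; move: E lambda_mu_gt0; lra. Qed.

Lemma speed_gt0 tau : 0 < speed tau.
Proof. by rewrite /speed; case: tau => //; move: mu_gt0 lambda_mu_gt0; lra. Qed.

(** The matrix with rows (n, - kappa) and (kappa, n) has determinant
    n^2 + kappa^2; the pair (0, 0) is the only degenerate one. *)
Lemma wavenumber_eq0 n k : (n%:R ^+ 2 + freq h k ^+ 2 == 0) = (n == 0)%N && (k == 0)%N.
Proof.
rewrite paddr_eq0 ?sqr_ge0// !sqrf_eq0 pnatr_eq0; congr (_ && _).
by apply/eqP/eqP => [kap0|->]; [apply: (freq_inj h_gt0); rewrite freq0|rewrite freq0].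
Qed.

(** Fields with distinct eigenvalues are orthogonal as solutions.  If the
    eigenvalues agree, either the wave numbers differ and the trigonometric
    factors are orthogonal, or the kinds agree, since the speeds differ, and
    only the phases differ. *)
Lemma eigenfields_orthogonal i j : admissible i -> admissible j -> i != j ->
  inner h (eigenfield i) (eigenfield j) = 0.
Proof.
move=> Ai Aj ij; have [eq|ne] := eqVneq (eigenvalue_of i) (eigenvalue_of j); last first.
  have := solution_eigenfield_orthogonal j (eigenfield_DF_solution i).
  by move=> /eqP; rewrite mulf_eq0 subr_eq0 (negbTE ne) => /eqP.
case: i j Ai Aj ij eq => -[n k] [sg tau] [[n' k'] [sg' tau']].
rewrite inner_eigenfields => Ai Aj ij eq.
have [nn|nn] := eqVneq n n'; last by rewrite !pairing_orth1// !mulr0 addr0.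
have [kk|kk] := eqVneq k k'; last first.
  by rewrite !pairing_orth2 ?mulr0 ?addr0//; [left|right].
move: Aj ij eq; rewrite -{}nn -{}kk {n' k'} => Aj ij eq.
have tt : tau = tau'.
  apply: speed_inj; move: eq; rewrite /eigenvalue_of => /mulIf; apply.
  rewrite wavenumber_eq0; apply/negP => /andP[/eqP n0 /eqP k0].
  move: Ai Aj ij; rewrite /admissible n0 k0/= !orbF !andbF.
  by case: tau sg tau' sg' => -[] [] [].
have ss : sg != sg' by apply: contraNneq ij => ->; rewrite tt.
have n0 : (0 < n)%N.
  rewrite lt0n; apply/negP => /eqP n0; move: Ai Aj; rewrite /admissible n0/= -tt.
  by move=> /andP[_ /eqP E1] /andP[_ /eqP E2]; move: ss; rewrite E1 E2 eqxx.
have := pairing_phase_orth k 0 0 n0 ss; rewrite !addr0 => ->.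
by rewrite pairing_phase_orth// !mulr0 addr0.
Qed.

Lemma eigenfield_norm_gt0 i : admissible i -> 0 < inner h (eigenfield i) (eigenfield i).
Proof.
case: i => -[n k] [sg tau]; rewrite inner_eigenfields -/(sqnorm _ _ _ _ _) -/(sqnorm _ _ _ _ _).
have b0 : boundary_phase (0 : R) by left.
have b1 : boundary_phase (- (pi / 2) : R) by right.
rewrite /admissible => /andP[]; case: tau => /=.
  move=> _; case: (posnP k) => [->|k0].
    move=> nsg; apply: ltr_wpDl; first by rewrite mulr_ge0 ?sqnorm_ge0// -expr2 sqr_ge0.
    apply: mulr_gt0.
      rewrite -expr2 exprn_even_gt0//= /amplitude2 pnatr_eq0 andbT.
      by case: (n).
    apply: sqnorm_gt0 => //; last by rewrite cos0 oner_eq0 orbT.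
    by case: (posnP n) nsg => //= _ /eqP ->; rewrite /phase cos0 oner_eq0.
  move=> nsg; apply: ltr_wpDr; first by rewrite mulr_ge0 ?sqnorm_ge0// -expr2 sqr_ge0.
  apply: mulr_gt0; first by rewrite -expr2 exprn_gt0//; exact: freq_gt0.
  apply: sqnorm_gt0 => //; last by rewrite k0.
  by case: (posnP n) nsg => //= _ /eqP ->; rewrite /phase subrr cos0 oner_eq0.
move=> k0 nsg; apply: ltr_wpDl; first by rewrite mulr_ge0 ?sqnorm_ge0// -expr2 sqr_ge0.
apply: mulr_gt0; first by rewrite /amplitude2 mulrNN -expr2 exprn_gt0//; exact: freq_gt0.
apply: sqnorm_gt0 => //; last by rewrite k0.
by case: (posnP n) nsg => //= _ /eqP ->; rewrite /phase cos0 oner_eq0.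
Qed.

Definition L2_field u := forall a, square_integrable h (u a).

Lemma eigenfield_L2 i : L2_field (eigenfield i).
Proof.
by case: i => -[n k] [sg tau] a; apply: square_integrable_continuous => //; exact: continuous_mode.
Qed.

Lemma solution_L2 Lam u : DF_solution lambda mu h Lam u -> L2_field u.
Proof. by move=> [Du [[L2u _] _ _ _]]. Qed.

Lemma cintegrable_inner u w : L2_field u -> L2_field w ->
  cintegrable h (fun p => \sum_(a < 2) u a p * w a p).
Proof.
move=> Lu Lw; apply: cintegrable_sum => a.
exact: (L2M (@cylinder_measurable R h) (Lu a) (Lw a)).
Qed.

Lemma L2_fieldZ (c : R) u : L2_field u -> L2_field (fun a p => c * u a p).
Proof. by move=> Lu a; exact: (L2Z (@cylinder_measurable R h) c (Lu a)). Qed.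

Lemma L2_fieldB u w : L2_field u -> L2_field w -> L2_field (fun a p => u a p - w a p).
Proof. by move=> Lu Lw a; exact: (L2B (@cylinder_measurable R h) (Lu a) (Lw a)). Qed.

Lemma L2_field_sum d (c : 'I_d -> R) (e : 'I_d -> vfield R) :
  (forall l, L2_field (e l)) -> L2_field (fun a p => \sum_(l < d) c l * e l a p).
Proof.
elim: d c e => [|d IH] c e Le a.
  rewrite (_ : (fun p => _) = cst 0); last by apply/funext => p; rewrite big_ord0.
  by apply: square_integrable_continuous => // p; exact: cvg_cst.
rewrite (_ : (fun p => _) = fun p => c ord0 * e ord0 a p +
    \sum_(l < d) c (lift ord0 l) * e (lift ord0 l) a p); last first.
  by apply/funext => p; rewrite big_ord_recl.
apply: (L2D (@cylinder_measurable R h)); first exact: L2_fieldZ.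
exact: (IH (fun l => c (lift ord0 l)) (fun l => e (lift ord0 l))).
Qed.

Lemma innerB u v w : L2_field u -> L2_field v -> L2_field w ->
  inner h (fun a p => u a p - v a p) w = inner h u w - inner h v w.
Proof.
move=> Lu Lv Lw; rewrite -cintB; [|exact: cintegrable_inner..].
by apply: eq_cint => p _; rewrite -sumrB; apply: eq_bigr => a _; rewrite mulrBl.
Qed.

Lemma inner_sum d (c : 'I_d -> R) (e : 'I_d -> vfield R) w :
  (forall l, L2_field (e l)) -> L2_field w ->
  inner h (fun a p => \sum_(l < d) c l * e l a p) w = \sum_(l < d) c l * inner h (e l) w.
Proof.
move=> Le Lw.
transitivity (\sum_(l < d) cint h (fun p => c l * \sum_(a < 2) e l a p * w a p)).
  rewrite -cint_sum => [|l]; last by apply: cintegrableZ; exact: cintegrable_inner.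
  apply: eq_cint => p _; rewrite [RHS](eq_bigr (fun l => \sum_(a < 2) c l * e l a p * w a p)).
    by rewrite exchange_big; apply: eq_bigr => a _; rewrite mulr_suml.
  by move=> l _; rewrite mulr_sumr; apply: eq_bigr => a _; rewrite mulrA.
by apply: eq_bigr => l _; rewrite cintZ//; exact: cintegrable_inner.
Qed.

Lemma vanishes_inner0 u w : L2_field u -> L2_field w -> vanishes h u -> inner h u w = 0.
Proof.
move=> Lu Lw vu; have mD := @cylinder_measurable R h.
have iuw := cintegrable_inner Lu Lw.
rewrite /inner /cint /Rintegral.
rewrite (@ae_eq_integral _ _ _ (area R) (cylinder h) (cst 0%E))//.
- by rewrite integral0.
- exact: measurable_int iuw.
- have FF : Filter (almost_everywhere (area R)) by exact: ae_filter_ringOfSetsType.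
  move: vu; apply: filterS => p vu Dp /=; congr EFin.
  by rewrite big1// => a _; rewrite vu// mul0r.
Qed.

(** For each n, k and phase, orthogonality to the compressional and the shear
    field is a linear system for the Fourier coefficients P and Q of the two
    components.  It is invertible unless n = k = 0, in which case P = 0 because
    its sine factor vanishes.  Other phases are combinations of the two. *)
Lemma eigenfields_complete u : L2_field u ->
  (forall i, inner h u (eigenfield i) = 0) -> vanishes h u.
Proof.
move=> Lu u0.
have iu a : cintegrable h (u a).
  have L1 : square_integrable h (fun=> 1).
    by apply: square_integrable_continuous => // p; exact: cvg_cst.
  rewrite (_ : u a = fun p => u a p * 1); last by apply/funext => p; rewrite mulr1.
  exact: (L2M (@cylinder_measurable R h) (Lu a) L1).
have iu0 n k sg : cintegrable h (fun p =>
    u 0 p * (sin (n%:R * p.1 + phase sg) * sin (freq h k * p.2))).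
  apply: (@cintegrableM_continuous _ _ (u 0)) => //.
  rewrite (_ : (fun p => _) = cosprod h n k (phase sg - pi / 2) (- (pi / 2))).
    exact: cosprod_continuous.
  by apply/funext => p; rewrite /cosprod /wave addrA !cosBpihalf mul1r.
have iu1 n k sg : cintegrable h (fun p =>
    u 1 p * (cos (n%:R * p.1 + phase sg) * cos (freq h k * p.2))).
  apply: (@cintegrableM_continuous _ _ (u 1)) => //.
  rewrite (_ : (fun p => _) = cosprod h n k (phase sg) 0).
    exact: cosprod_continuous.
  by apply/funext => p; rewrite /cosprod /wave addr0 mul1r.
pose P n k sg := cint h (fun p =>
  u 0 p * (sin (n%:R * p.1 + phase sg) * sin (freq h k * p.2))).
pose Q n k sg := cint h (fun p =>
  u 1 p * (cos (n%:R * p.1 + phase sg) * cos (freq h k * p.2))).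
have E n k sg tau : amplitude1 n k tau * P n k sg + amplitude2 n k tau * Q n k sg = 0.
  rewrite -(u0 (n, k, (sg, tau))) -cintZ// -cintZ// -cintD; [|exact: cintegrableZ..].
  by apply: eq_cint => p _; rewrite sum2E /eigenfield mode1E mode2E; ring.
have PQ n k sg : P n k sg = 0 /\ Q n k sg = 0.
  have E1 := E n k sg false; have E2 := E n k sg true.
  have [nk0|nk0] := boolP ((n == 0)%N && (k == 0)%N).
    split.
      rewrite /P; move: nk0 => /andP[_ /eqP ->].
      rewrite (eq_cint (g := fun=> 0)) ?cint0// => p _.
      by rewrite freq0 mul0r sin0 !mulr0.
    move: E2; rewrite /amplitude1 /amplitude2 nk0; move: nk0 => /andP[/eqP -> /eqP ->].
    by rewrite freq0 mul0r add0r mul1r.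
  move: E1 E2; rewrite /amplitude1 /amplitude2 (negbTE nk0) addn0.
  move: nk0; rewrite -wavenumber_eq0.
  move: (n%:R : R) (freq h k) (P n k sg) (Q n k sg) => a b x y ab E1 E2.
  split; apply/(mulfI ab); rewrite mulr0.
    transitivity (a * (a * x + - b * y) + b * (b * x + a * y)); first by ring.
    by rewrite E1 E2 !mulr0 addr0.
  transitivity (a * (b * x + a * y) - b * (a * x + - b * y)); first by ring.
  by rewrite E1 E2 !mulr0 subr0.
have v0 : {ae area R, forall p, cylinder h p -> u 0 p = 0}.
  apply: (fourier_sin_complete h_gt0 (iu 0)) => n phi k.
  have [[S0 _] [S1 _]] := (PQ n k false, PQ n k true).
  transitivity (cos phi * P n k true - sin phi * P n k false).
    rewrite -cintZ// -cintZ// -cintB; [|exact: cintegrableZ..].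
    by apply: eq_cint => p _; rewrite /phase sinDpihalf addr0 cosD; ring.
  by rewrite S0 S1 !mulr0 subr0.
have v1 : {ae area R, forall p, cylinder h p -> u 1 p = 0}.
  apply: (fourier_cos_complete h_gt0 (iu 1)) => n phi k.
  have [[_ S0] [_ S1]] := (PQ n k false, PQ n k true).
  transitivity (cos phi * Q n k false + sin phi * Q n k true).
    rewrite -cintZ// -cintZ// -cintD; [|exact: cintegrableZ..].
    by apply: eq_cint => p _; rewrite /phase cosDpihalf addr0 cosD; ring.
  by rewrite S0 S1 !mulr0 addr0.
have FF : Filter (almost_everywhere (area R)) by exact: ae_filter_ringOfSetsType.
move: v0 v1; apply: filterS2 => p v0 v1 Dp a.
by case: (ord2P a) => ->; [exact: v0|exact: v1].
Qed.

(** Subtract from a solution its orthogonal projection onto the span of the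
    fields indexed by s.  The rest is orthogonal to these, and to all other
    eigenfields because their eigenvalues differ from Lam; by completeness it
    vanishes. *)
Lemma multiplicity_enum Lam (s : seq mode_index) : uniq s ->
  (forall i, (i \in s) = admissible i && (eigenvalue_of i == Lam)) ->
  DF_multiplicity lambda mu h Lam (size s).
Proof.
move=> us sE; pose e (l : 'I_(size s)) := eigenfield (tnth (in_tuple s) l).
have adm l : admissible (tnth (in_tuple s) l).
  by have := mem_tnth l (in_tuple s); rewrite sE => /andP[].
have eig l : eigenvalue_of (tnth (in_tuple s) l) = Lam.
  by have := mem_tnth l (in_tuple s); rewrite sE => /andP[_ /eqP].
have Le l : L2_field (e l) by exact: eigenfield_L2.
have orth l m : l != m -> inner h (e l) (e m) = 0.
  move=> lm; apply: eigenfields_orthogonal => //.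
  by apply: contra_neq lm; exact: (elimT (tuple_uniqP (in_tuple s)) us).
have norm l : inner h (e l) (e l) != 0 by rewrite gt_eqF// eigenfield_norm_gt0.
have pick c m : \sum_(l < size s) c l * inner h (e l) (e m) = c m * inner h (e m) (e m).
  by rewrite (bigD1 m)//= big1 ?addr0// => l lm; rewrite orth// mulr0.
exists e; split.
- by move=> l; rewrite -(eig l); exact: eigenfield_DF_solution.
- move=> c vc m; have := vanishes_inner0 (L2_field_sum c Le) (Le m) vc.
  rewrite inner_sum// pick => /eqP; rewrite mulf_eq0 (negbTE (norm m)) orbF.
  by move/eqP.
- move=> u su; have Lu := solution_L2 su.
  exists (fun l => inner h u (e l) / inner h (e l) (e l)).
  apply: eigenfields_complete => [|i]; first exact: L2_fieldB Lu (L2_field_sum _ Le).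
  have [Ai|nAi] := boolP (admissible i); last first.
    rewrite /inner (eq_cint (g := fun=> 0)) ?cint0// => p _.
    by rewrite big1// => a _; rewrite inadmissible_eigenfield0// mulr0.
  rewrite innerB//; [|exact: L2_field_sum|exact: eigenfield_L2].
  rewrite inner_sum//; last exact: eigenfield_L2.
  have [eqL|neL] := eqVneq (eigenvalue_of i) Lam.
    have : i \in in_tuple s by rewrite sE Ai eqL eqxx.
    by move=> /tnthP[m ->]; rewrite -/(e m) pick divfK ?subrr.
  have := solution_eigenfield_orthogonal i su; move/eqP.
  rewrite mulf_eq0 subr_eq0 eq_sym (negbTE neL) => /eqP ->.
  rewrite big1 ?subr0// => l _.
  rewrite [inner h (e l) (eigenfield i)]eigenfields_orthogonal ?mulr0//.
  by apply: contra_neq neL => <-; exact: eig.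
Qed.

Lemma DF_eigenvalue_multiplicity_gt0 Lam d : DF_multiplicity lambda mu h Lam d ->
  DF_eigenvalue lambda mu h Lam <-> (0 < d)%N.
Proof.
move=> [e [se ind span]]; split=> [[u su nu]|d0].
  rewrite lt0n; apply/negP => /eqP d0; apply: nu; have [c] := span u su.
  have FF : Filter (almost_everywhere (area R)) by exact: ae_filter_ringOfSetsType.
  apply: filterS => p vp Dp a; have := vp Dp a.
  by rewrite big1 ?subr0// => l _; exfalso; case: l => m; rewrite d0.
have [l0 _] : exists l0 : 'I_d, true by exists (Ordinal d0).
exists (e l0) => // ve.
have v0 : vanishes h (fun a p => \sum_(l < d) (l == l0)%:R * e l a p).
  have FF : Filter (almost_everywhere (area R)) by exact: ae_filter_ringOfSetsType.
  move: ve; apply: filterS => p vp Dp a.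
  rewrite (bigD1 l0)//= eqxx mul1r vp// add0r big1// => l /negbTE ->.
  by rewrite mul0r.
have := ind (fun l => (l == l0)%:R) v0 l0.
by move=> /=; rewrite eqxx => /eqP; rewrite oner_eq0.
Qed.

End EigenFields.

(** * Counting the eigenfields *)

Section Counting.
Context {R : realType}.
Variables (lambda mu h : R).
Hypotheses (h_gt0 : 0 < h) (mu_gt0 : 0 < mu) (lambda_mu_gt0 : 0 < lambda + mu).
Implicit Types (n k : nat) (sg tau : bool) (Lam c : R).

(** Since k^2 >= k for natural k, the elements of A are at most Lam / c. *)
Lemma finite_squares c Lam (A : set nat) : 0 < c ->
  (forall k, A k -> k%:R ^+ 2 * c <= Lam) -> finite_set A.
Proof.
move=> c0 Ac; pose N := Num.bound (Lam / c).
apply: (sub_finite_set _ (finite_II N.+1)) => k Ak /=.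
rewrite ltnNge; apply/negP => Nk.
have k1 : (1 <= k)%N by apply: leq_trans Nk.
have kL : (k%:R : R) <= Lam / c.
  rewrite ler_pdivlMr//; apply: le_trans (Ac k Ak); apply: ler_wpM2r; first exact: ltW.
  by rewrite expr2 ler_peMl ?ler0n// ler1n.
have := @archi_boundP _ (Lam / c) (le_trans (ler0n _ k) kL).
by rewrite ltNge (le_trans _ kL)// ler_nat ltnW.
Qed.

Lemma finite_square_pairs c c' Lam (A : set (nat * nat)) : 0 < c -> 0 < c' ->
  (forall nk, A nk -> nk.1%:R ^+ 2 * c + nk.2%:R ^+ 2 * c' <= Lam) -> finite_set A.
Proof.
move=> c0 c'0 Ac.
pose B1 := [set n | n%:R ^+ 2 * c <= Lam]; pose B2 := [set k | k%:R ^+ 2 * c' <= Lam].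
apply: (@sub_finite_set _ _ (B1 `*` B2)).
  move=> [n k] /Ac/= nk; split=> /=; rewrite /B1 /B2/=.
    by apply: le_trans nk; rewrite lerDl mulr_ge0 ?sqr_ge0// ltW.
  by apply: le_trans nk; rewrite lerDr mulr_ge0 ?sqr_ge0// ltW.
by apply: finite_setX; [exact: (finite_squares c0 (fun k H => H))|
  exact: (finite_squares c'0 (fun k H => H))].
Qed.

Lemma mem_fset_set_pos (T : choiceType) (p : T -> bool) (q : T -> R) Lam :
  finite_set [set x | p x /\ Lam = q x] ->
  forall x, (x \in fset_set [set x | p x /\ Lam = q x]) = p x && (Lam == q x).
Proof.
move=> fA x; rewrite in_fset_set//; apply/idP/idP; rewrite inE/=.
  by move=> [-> ->]; rewrite eqxx.
by move=> /andP[-> /eqP].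
Qed.

(** The five series as indices of eigenfields, in order.  For n = 0 only one
    phase is admissible; in the last three series both occur, whence the
    factor 2. *)
Definition listing (F1 F2 F3 : {fset nat}) (F4 F5 : {fset nat * nat}) : seq mode_index :=
  [seq (0, k, (false, false)) | k <- F1] ++ [seq (0, k, (true, true)) | k <- F2] ++
  [seq (n, 0, (sg, true)) | n <- F3, sg <- [:: false; true]] ++
  [seq (nk, (sg, true)) | nk <- F4, sg <- [:: false; true]] ++
  [seq (nk, (sg, false)) | nk <- F5, sg <- [:: false; true]].

Lemma size_listing F1 F2 F3 F4 F5 : size (listing F1 F2 F3 F4 F5) =
  (#|` F1| + #|` F2| + 2 * #|` F3| + 2 * #|` F4| + 2 * #|` F5|)%N.
Proof.
by rewrite !size_cat !size_map !size_allpairs /= ![(_ * 2)%N]mulnC !addnA.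
Qed.

Lemma mem_listing F1 F2 F3 F4 F5 n k sg tau :
  ((n, k, (sg, tau)) \in listing F1 F2 F3 F4 F5) =
  [|| [&& (n == 0)%N, ~~ sg, ~~ tau & k \in F1], [&& (n == 0)%N, sg, tau & k \in F2],
      [&& (k == 0)%N, tau & n \in F3], tau && ((n, k) \in F4) | ~~ tau && ((n, k) \in F5)].
Proof.
have bI (b : bool) : b \in [:: false; true] by case: b.
rewrite !mem_cat; congr [|| _, _, _, _ | _].
- apply/mapP/and4P => [[l lF [-> -> -> ->]]//|[/eqP -> /negPf -> /negPf -> kF]].
  by exists k.
- apply/mapP/and4P => [[l lF [-> -> -> ->]]//|[/eqP -> -> -> kF]].
  by exists k.
- apply/allpairsP/and3P => [[[l b] /= [lF _ [-> -> _ ->]]]//|[/eqP -> -> nF]].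
  by exists (n, sg).
- apply/allpairsP/andP => [[[l b] /= [lF _ [-> _ ->]]]//|[-> nF]].
  by exists (n, k, sg).
- apply/allpairsP/andP => [[[l b] /= [lF _ [-> _ ->]]]//|[/negPf -> nF]].
  by exists (n, k, sg).
Qed.

(** The series to which an index belongs can be read off from the index (the
    function cl), so that the five parts are disjoint. *)
Lemma uniq_listing F1 F2 F3 F4 F5 : (0%N \notin F3) ->
  (forall nk, nk \in F4 -> (0 < nk.1)%N && (0 < nk.2)%N) ->
  (forall nk, nk \in F5 -> (0 < nk.1)%N && (0 < nk.2)%N) ->
  uniq (listing F1 F2 F3 F4 F5).
Proof.
move=> F3p F4p F5p.
pose cl (i : mode_index) : nat := let: (n, k, (sg, tau)) := i in
  if (n == 0)%N then if tau then 1%N else 0%N else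
  if ~~ tau then 4%N else if (k == 0)%N then 2%N else 3%N.
have uniq_cat_class (s t : seq mode_index) (m : nat) : uniq s -> uniq t ->
    {in s, forall i, cl i = m} -> {in t, forall i, (m < cl i)%N} -> uniq (s ++ t).
  move=> us ut sc tc; rewrite cat_uniq us ut andbT/=; apply/hasPn => i it.
  by apply/negP => /sc ic; have := tc _ it; rewrite ic ltnn.
have F3n n : n \in F3 -> n != 0%N by move=> nF; apply: contraNneq F3p => <-.
have pairs (b : bool) (F : {fset nat * nat}) :
    uniq [seq (nk, (sg, b)) | nk <- F, sg <- [:: false; true]].
  by apply: allpairs_uniq; rewrite ?fset_uniq// => -[x y] [x' y'] _ _ /= [-> ->].
apply: (uniq_cat_class _ _ 0%N); first by rewrite map_inj_uniq ?fset_uniq// => k k' [].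
- apply: (uniq_cat_class _ _ 1%N); first by rewrite map_inj_uniq ?fset_uniq// => k k' [].
  + apply: (uniq_cat_class _ _ 2%N).
    * by apply: allpairs_uniq; rewrite ?fset_uniq// => -[x y] [x' y'] _ _ /= [-> ->].
    * apply: (uniq_cat_class _ _ 3%N) => //.
      -- by move=> _ /allpairsP[[[n k] sg] /= [/F4p/andP[n0 k0] _ ->]]; rewrite /= !gtn_eqF.
      -- by move=> _ /allpairsP[[[n k] sg] /= [/F5p/andP[n0 k0] _ ->]]; rewrite /= !gtn_eqF.
    * by move=> _ /allpairsP[[n sg] /= [/F3n/negPf nF _ ->]]; rewrite /= nF.
    * move=> i; rewrite mem_cat => /orP[] /allpairsP[[[n k] sg] /= [+ _ ->]] /=.
        by move=> /F4p/andP[n0 k0]; rewrite !gtn_eqF.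
      by move=> /F5p/andP[n0 k0]; rewrite !gtn_eqF.
  + by move=> _ /mapP[k _ ->].
  + move=> i; rewrite !mem_cat => /or3P[] /allpairsP.
    * by move=> [[n sg] /= [/F3n/negPf nF _ ->]]; rewrite /= nF.
    * by move=> [[[n k] sg] /= [/F4p/andP[n0 k0] _ ->]]; rewrite /= !gtn_eqF.
    * by move=> [[[n k] sg] /= [/F5p/andP[n0 k0] _ ->]]; rewrite /= !gtn_eqF.
- by move=> _ /mapP[k _ ->].
- move=> i; rewrite !mem_cat => /or4P[].
  + by move=> /mapP[k _ ->].
  + by move=> /allpairsP[[n sg] /= [/F3n/negPf nF _ ->]]; rewrite /= nF.
  + by move=> /allpairsP[[[n k] sg] /= [/F4p/andP[n0 k0] _ ->]]; rewrite /= !gtn_eqF.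
  + by move=> /allpairsP[[[n k] sg] /= [/F5p/andP[n0 k0] _ ->]]; rewrite /= !gtn_eqF.
Qed.

Lemma freqE2 k : freq h k ^+ 2 = k%:R ^+ 2 * pi ^+ 2 / h ^+ 2.
Proof. by rewrite /freq !exprMn exprVn. Qed.

(** For Lam <> 0, n = k = 0 is excluded, and the remaining cases of n = 0 or
    k = 0 match the five series one by one. *)
Lemma listed_enumeration Lam : Lam != 0 -> exists s : seq mode_index,
  [/\ uniq s, forall i, (i \in s) = admissible i && (eigenvalue_of lambda mu h i == Lam) &
   size s = listed_multiplicity lambda mu h Lam].
Proof.
move=> Lam0; have lm_gt0 : 0 < lambda + 2 * mu by move: mu_gt0 lambda_mu_gt0; lra.
have pi2h : 0 < pi ^+ 2 / h ^+ 2 :> R by rewrite divr_gt0 ?exprn_gt0 ?pi_gt0.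
rewrite /listed_multiplicity.
set A1 := [set k : nat | _]; set A2 := [set k : nat | _]; set A3 := [set n : nat | _].
set A4 := [set nk : nat * nat | _]; set A5 := [set nk : nat * nat | _].
have f1 : finite_set A1.
  apply: (@finite_squares (pi ^+ 2 / h ^+ 2 * (lambda + 2 * mu)) Lam); first exact: mulr_gt0.
  by move=> k [_ ->]; rewrite !mulrA.
have f2 : finite_set A2.
  apply: (@finite_squares (pi ^+ 2 / h ^+ 2 * mu) Lam); first exact: mulr_gt0.
  by move=> k [_ ->]; rewrite !mulrA.
have f3 : finite_set A3.
  by apply: (@finite_squares mu Lam) => // k [_ ->].
have f4 : finite_set A4.
  apply: (@finite_square_pairs mu (pi ^+ 2 / h ^+ 2 * mu) Lam) => //; first exact: mulr_gt0.
  by move=> nk [_ _ ->]; rewrite mulrDl !mulrA.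
have f5 : finite_set A5.
  apply: (@finite_square_pairs (lambda + 2 * mu)
    (pi ^+ 2 / h ^+ 2 * (lambda + 2 * mu)) Lam) => //.
    exact: mulr_gt0.
  by move=> nk [_ _ ->]; rewrite le_eqVlt; apply/orP; left; apply/eqP; ring.
have m1 k : (k \in fset_set A1) =
    (0 < k)%N && (Lam == k%:R ^+ 2 * pi ^+ 2 / h ^+ 2 * (lambda + 2 * mu)).
  exact: (@mem_fset_set_pos _ (fun k => (0 < k)%N)
    (fun k => k%:R ^+ 2 * pi ^+ 2 / h ^+ 2 * (lambda + 2 * mu)) Lam f1).
have m2 k : (k \in fset_set A2) = (0 < k)%N && (Lam == k%:R ^+ 2 * pi ^+ 2 / h ^+ 2 * mu).
  exact: (@mem_fset_set_pos _ (fun k => (0 < k)%N)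
    (fun k => k%:R ^+ 2 * pi ^+ 2 / h ^+ 2 * mu) Lam f2).
have m3 n : (n \in fset_set A3) = (0 < n)%N && (Lam == n%:R ^+ 2 * mu).
  exact: (@mem_fset_set_pos _ (fun n => (0 < n)%N) (fun n => n%:R ^+ 2 * mu) Lam f3).
have m4 nk : (nk \in fset_set A4) = [&& (0 < nk.1)%N, (0 < nk.2)%N &
    Lam == (nk.1%:R ^+ 2 + nk.2%:R ^+ 2 * pi ^+ 2 / h ^+ 2) * mu].
  rewrite in_fset_set//; apply/idP/and3P; rewrite inE.
    by move=> [-> -> ->]; rewrite eqxx.
  by move=> [n0 k0 /eqP E]; split.
have m5 nk : (nk \in fset_set A5) = [&& (0 < nk.1)%N, (0 < nk.2)%N &
    Lam == (nk.1%:R ^+ 2 + nk.2%:R ^+ 2 * pi ^+ 2 / h ^+ 2) * (lambda + 2 * mu)].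
  rewrite in_fset_set//; apply/idP/and3P; rewrite inE.
    by move=> [-> -> ->]; rewrite eqxx.
  by move=> [n0 k0 /eqP E]; split.
exists (listing (fset_set A1) (fset_set A2) (fset_set A3) (fset_set A4) (fset_set A5)); split.
- apply: uniq_listing; first by rewrite m3.
    by move=> nk; rewrite m4 => /and3P[-> ->].
  by move=> nk; rewrite m5 => /and3P[-> ->].
- move=> [[n k] [sg tau]]; rewrite mem_listing m1 m2 m3 m4 m5 /admissible /eigenvalue_of /=.
  rewrite freqE2 [_ == Lam]eq_sym.
  case: (posnP n) => [->|n0]; case: (posnP k) => [->|k0] /=.
  + have -> : speed lambda mu tau * (0 ^+ 2 + 0 ^+ 2 * pi ^+ 2 / h ^+ 2) = 0.
      by rewrite !expr0n/= !mul0r addr0 mulr0.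
    by rewrite (negbTE Lam0) !andbF !orbF.
  + by rewrite expr0n/= add0r [speed _ _ _ * _]mulrC; case: tau; case: sg => //=; rewrite ?andbF ?orbF.
  + by rewrite expr0n/= !mul0r addr0 [speed _ _ _ * _]mulrC; case: tau => //=; rewrite ?andbF ?orbF.
  + by rewrite [speed _ _ _ * _]mulrC; case: tau => //=; rewrite ?andbF ?orbF.
- exact: size_listing.
Qed.

(** The eigenvalue 0 requires n = k = 0, and the only admissible index there is
    that of the constant field. *)
Lemma zero_enumeration i :
  (i \in [:: (0, 0, (false, true))]%N) = admissible i && (eigenvalue_of lambda mu h i == 0).
Proof.
case: i => -[n k] [sg tau]; rewrite inE /eigenvalue_of mulf_eq0 gt_eqF ?speed_gt0//=.
rewrite wavenumber_eq0// !xpair_eqE /admissible.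
by case: n => [|n]; case: k => [|k]; case: sg; case: tau.
Qed.

End Counting.

(* The constant field (0, 1) solves the problem with eigenvalue 0, which none   *)
(* of the series contains; it is accounted for by the last two conjuncts.       *)
Theorem theorem3p1 (R : realType) (lambda mu h : R)
  (h_gt0 : 0 < h) (mu_gt0 : 0 < mu) (lambda_mu_gt0 : 0 < lambda + mu) :
  [/\ forall Lam : R, Lam != 0 ->
        (DF_eigenvalue lambda mu h Lam <->
           (0 < listed_multiplicity lambda mu h Lam)%N) /\
        DF_multiplicity lambda mu h Lam (listed_multiplicity lambda mu h Lam),
      DF_eigenvalue lambda mu h 0 &
      DF_multiplicity lambda mu h 0 1].
Proof.
have M0 : DF_multiplicity lambda mu h 0 1.
  have us : uniq [:: (0, 0, (false, true))]%N by [].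
  have zE := zero_enumeration h_gt0 mu_gt0 lambda_mu_gt0.
  exact: (multiplicity_enum h_gt0 lambda_mu_gt0 us zE).
split=> [Lam Lam0||//]; last exact/(DF_eigenvalue_multiplicity_gt0 M0).
have [s [us sE <-]] := listed_enumeration h_gt0 mu_gt0 lambda_mu_gt0 Lam0.
have M := multiplicity_enum h_gt0 lambda_mu_gt0 us sE.
by split; [exact: DF_eigenvalue_multiplicity_gt0|].
Qed.
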